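(* Let $k\ge 1$, $m>k$ and $e\ge 2$ be fixed integers and let $\mathcal{J}$ be a fixed $k$-graph on $m$ vertices with at least $2$ edges. Then for every $\epsilon>0$ there exists an integer $n_0$ such that for all $n\ge n_0$ there exists a $\mathcal{J}$-packing $\mathcal{P}=\{(V(\mathcal{J}_i),\mathcal{J}_i): i\in[|\mathcal{P}|]\}$ in $\binom{[n]}{k}$ such that the following conditions hold: (i) $\mathcal{P}$ is induced; (ii) $\mathcal{P}$ is $e$-locally sparse; (iii) $\mathcal{P}$ is near-optimal, i.e., $|\mathcal{P}|\ge(1-\epsilon)\binom{n}{k}/|\mathcal{J}|$.
   Context: $[n]=\{1,\dots,n\}$ and $\binom{V}{k}$ is the family of all $k$-subsets of $V$. A $k$-graph $\mathcal{J}$ on a vertex set $V(\mathcal{J})$ is a family of distinct $k$-subsets of $V(\mathcal{J})$ (isolated vertices are allowed), and $|\mathcal{J}|$ is its number of edges. For a fixed $k$-graph $\mathcal{J}$, a $\mathcal{J}$-packing $\mathcal{P}$ in $\binom{[n]}{k}$ is a family $\mathcal{P}=\{(V(\mathcal{J}_i),\mathcal{J}_i): i\in[|\mathcal{P}|]\}$ where for each $i$, $V(\mathcal{J}_i)\subseteq[n]$ and $\mathcal{J}_i\subseteq\binom{V(\mathcal{J}_i)}{k}$ is a copy of $\mathcal{J}$ with vertex set $V(\mathcal{J}_i)$ (so $|V(\mathcal{J}_i)|=|V(\mathcal{J})|$), and the copies are pairwise edge-disjoint: $\mathcal{J}_i\cap\mathcal{J}_{i'}=\emptyset$ for distinct $i,i'$.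 The packing $\mathcal{P}$ is induced if for all distinct $i,i'$ we have $|V(\mathcal{J}_i)\cap V(\mathcal{J}_{i'})|\le k$, and whenever $|V(\mathcal{J}_i)\cap V(\mathcal{J}_{i'})|=k$, the set $V(\mathcal{J}_i)\cap V(\mathcal{J}_{i'})$ is neither an edge of $\mathcal{J}_i$ nor an edge of $\mathcal{J}_{i'}$. A hypergraph $\mathcal{H}$ is $(v,\ell)$-free if the union of any $\ell$ distinct edges of $\mathcal{H}$ has at least $v+1$ vertices. If $\mathcal{J}$ has $m$ vertices and $e\ge 2$, the packing $\mathcal{P}$ is $e$-locally sparse if the $m$-graph $\{V(\mathcal{J}_i): i\in[|\mathcal{P}|]\}\subseteq\binom{[n]}{m}$ is $(\ell m-(\ell-1)k-1,\ell)$-free for every $2\le\ell\le e$; that is, for every $2\le \ell\le e$ and any $\ell$ distinct indices, the union of the corresponding sets $V(\mathcal{J}_i)$ has at least $\ell m-(\ell-1)k$ elements. *)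

(* Defs.v *)
From mathcomp Require Import all_boot all_order all_algebra reals.

Set Implicit Arguments.
Unset Strict Implicit.
Unset Printing Implicit Defensive.

Record hypergraph (T : finType) := Hypergraph {
  vset : {set T};
  edges : {set {set T}}
}.

Definition is_kgraph (k : nat) (T : finType) (H : hypergraph T) : Prop :=
  forall E : {set T}, E \in edges H -> E \subset vset H /\ #|E| = k.

(* Only the values of f on vset J matter. *)
Definition is_copy (U T : finType) (J : hypergraph U) (H : hypergraph T) : Prop :=
  exists f : U -> T,
    [/\ {in vset J &, injective f},
        vset H = f @: vset J
      & edges H = [set f @: E | E : {set U} in edges J]].

(* The ground set [n] is 'I_n, and a packing with N members is an indexed
   family P : 'I_N -> hypergraph 'I_n. *)
Definition is_packing (U : finType) (J : hypergraph U) (n N : nat)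
    (P : 'I_N -> hypergraph 'I_n) : Prop :=
  (forall i, is_copy J (P i)) /\
  (forall i j, i != j -> [disjoint edges (P i) & edges (P j)]).

Definition is_induced (k n N : nat) (P : 'I_N -> hypergraph 'I_n) : Prop :=
  forall i j, i != j ->
    #|vset (P i) :&: vset (P j)| <= k /\
    (#|vset (P i) :&: vset (P j)| = k ->
       vset (P i) :&: vset (P j) \notin edges (P i) /\
       vset (P i) :&: vset (P j) \notin edges (P j)).

Definition is_free (v l : nat) (T : finType) (H : {set {set T}}) : Prop :=
  forall F : {set {set T}}, F \subset H -> #|F| = l -> v + 1 <= #|cover F|.

Definition vertex_sets (n N : nat) (P : 'I_N -> hypergraph 'I_n) :
    {set {set 'I_n}} :=
  [set vset (P i) | i : 'I_N].

(* The subtractions are truncated, harmlessly when k < m and 2 <= l. *)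
Definition locally_sparse (k m e n N : nat) (P : 'I_N -> hypergraph 'I_n) :
    Prop :=
  forall l : nat, 2 <= l <= e ->
    is_free (l * m - (l - 1) * k - 1) l (vertex_sets P).

(* An induced packing by copies on m > k vertices has pairwise distinct vertex
   sets, so local sparsity may equally be read over distinct indices. *)
Lemma induced_vset_inj (k m n N : nat) (P : 'I_N -> hypergraph 'I_n) :
  k < m -> (forall i, #|vset (P i)| = m) -> is_induced k P ->
  injective (fun i => vset (P i)).
Proof.
move=> km Pm indP i j /= eqV; apply/eqP; apply: contraLR km => nij.
by have [+ _] := indP i j nij; rewrite -eqV setIid Pm -leqNgt.
Qed.

Lemma locally_sparse_indexE (k m e n N : nat) (P : 'I_N -> hypergraph 'I_n) :
  k < m -> (forall i, #|vset (P i)| = m) -> is_induced k P ->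
  locally_sparse k m e P <->
  (forall l, 2 <= l <= e -> forall S : {set 'I_N}, #|S| = l ->
     l * m - (l - 1) * k <= #|\bigcup_(i in S) vset (P i)|).
Proof.
move=> km Pm indP; have injP := induced_vset_inj km Pm indP.
have bnd l : 2 <= l -> l * m - (l - 1) * k - 1 + 1 = l * m - (l - 1) * k.
  move=> l2; apply: subnK; rewrite subn_gt0.
  apply: (@leq_ltn_trans (l * k)); first by rewrite leq_mul2r leq_subr orbT.
  by rewrite ltn_mul2l km (ltnW l2).
have cov (S : {set 'I_N}) :
    cover [set vset (P i) | i in S] = \bigcup_(i in S) vset (P i).
  by rewrite /cover big_imset //= => i j _ _; apply: injP.
split=> sp l /[dup] le /andP[l2 _].
  move=> S Sl; rewrite -(bnd l l2) -cov.
  by apply: sp => //; [apply/imsetS/subsetP | rewrite card_imset].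
move=> F FH Fl; rewrite (bnd l l2).
have defF : F = [set vset (P i) | i in [set i | vset (P i) \in F]].
  apply/setP=> W; apply/idP/imsetP => [WF|[i]]; last by rewrite inE => iF ->.
  have /imsetP[i _ defW] := subsetP FH _ WF.
  by exists i; rewrite // inE -defW.
rewrite defF cov; apply: sp => //.
by rewrite -Fl [in RHS]defF card_imset.
Qed.

(* Main.v *)
Require Import Defs.
From mathcomp Require Import all_boot all_order all_algebra reals.
From mathcomp Require Import ring lra zify.

Set Implicit Arguments.
Unset Strict Implicit.
Unset Printing Implicit Defensive.

Import Order.TTheory GRing.Theory Num.Theory.
Local Open Scope ring_scope.

(** A nibble whose bad events are controlled in expectation only.  The points are
    the k-subsets of [n], the blocks are the injections c : V(J) -> [n]; A c is
    the set of images of edges of J, and B c that of the other k-subsets of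
    V(J).

    First keep a random set G of points, each with probability 1 - be; the
    blocks c with A c inside G and B c outside G are induced copies of J in G.
    Then, in each of T rounds, sample every block with probability q = L / (T D),
    D being the common degree, and use the sampled blocks c such that A c is
    still uncovered and B c misses G.  As codegrees are o(D), disjoint sets of
    points S and S' of bounded size satisfy
       P (S lies in G, S is uncovered after t rounds and S' misses G)
          = (p_t) ^ #|S| * be ^ #|S'| + o(1),
    by induction on t: the number of usable blocks through S is concentrated by
    a second moment, which involves the same events for larger sets at time t.
    So nearly all points of G get covered when L is large, and a proportion
    O(L^2 / T) of the points is covered twice in the same round.

    The number of l-sets of blocks spanning fewer than l m - (l - 1) k vertices
    is O(n ^ (l m - (l - 1) k - 1)), and such a set is sampled with probability
    (L / D) ^ l = O(n ^ (- l (m - k))).  This leaves O(n ^ (k - 1)) conflicts,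
    which can be deleted.  A k-set common to two vertex sets is a point in G or
    a point outside G, hence an edge of both copies or of neither, and the first
    is excluded since the copies are edge-disjoint. *)

(** * Random subsets with independent elements *)

Section Bernoulli.
Context {R : realType} {T : finType}.
Implicit Types (S : {set T}) (f g : {set T} -> R).

Definition bern_weight (q : R) S : R :=
  \prod_(i : T) (if i \in S then q else 1 - q).

(** The expectation of [f] at a random subset of [T] that keeps each element independently with
    probability [q]. *)
Definition bern (q : R) f : R := \sum_(S : {set T}) bern_weight q S * f S.

Lemma bern_weight_ge0 (q : R) S : 0 <= q <= 1 -> 0 <= bern_weight q S.
Proof.
by move=> /andP[q0 q1]; apply: prodr_ge0 => i _; case: ifP; rewrite ?subr_ge0.
Qed.

(** Expanding the right-hand product decides for each element whether it is kept: independence is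
    distributivity. *)
Lemma bern_prod (q : R) (u v : T -> R) :
  bern q (fun S => \prod_i (if i \in S then u i else v i)) =
  \prod_i (q * u i + (1 - q) * v i).
Proof.
rewrite bigA_distr; apply: eq_bigr => S _.
rewrite -big_split /=; apply: eq_bigr => i _.
by case: ifP.
Qed.

Lemma eq_bern (q : R) f g : f =1 g -> bern q f = bern q g.
Proof. by move=> fg; apply: eq_bigr => S _; rewrite fg. Qed.

Lemma bern_cst (q a : R) : bern q (fun=> a) = a.
Proof.
rewrite /bern -mulr_suml -[RHS]mul1r; congr (_ * _).
have := bern_prod q (fun=> 1) (fun=> 1).
rewrite [RHS]big1 => [<-|i _]; last by rewrite !mulr1 addrC subrK.
apply: eq_bigr => S _.
by rewrite [X in _ * X]big1 ?mulr1 // => i _; rewrite if_same.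
Qed.

Lemma bernD (q : R) f g : bern q (fun S => f S + g S) = bern q f + bern q g.
Proof. by rewrite -big_split; apply: eq_bigr => S _; rewrite mulrDr. Qed.

Lemma bernZ (q a : R) f : bern q (fun S => a * f S) = a * bern q f.
Proof. by rewrite mulr_sumr; apply: eq_bigr => S _; rewrite mulrCA. Qed.

Lemma bern_sum (q : R) (I : finType) (P : pred I) (F : I -> {set T} -> R) :
  bern q (fun S => \sum_(i | P i) F i S) = \sum_(i | P i) bern q (F i).
Proof.
rewrite /bern exchange_big /=; apply: eq_bigr => S _.
by rewrite mulr_sumr.
Qed.

Lemma ler_bern (q : R) f g :
  0 <= q <= 1 -> (forall S, f S <= g S) -> bern q f <= bern q g.
Proof.
move=> q01 fg; apply: ler_sum => S _.
by apply: ler_wpM2l (fg S); apply: bern_weight_ge0.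
Qed.

(** First moment method: were [f] above [a] everywhere, the nonnegative terms
    [bern_weight q S * (f S - a)] would have a sum of at most 0, so every weight would vanish, while
    the weights add up to 1. *)
Lemma bern_le_ex (q a : R) f :
  0 <= q <= 1 -> bern q f <= a -> exists S, f S <= a.
Proof.
move=> q01 fa; case: (pickP [pred S | f S <= a]) => [S /= Sa|Sa]; first by exists S.
have fgt S : a < f S by rewrite ltNge; apply/negbT; apply: Sa.
have w0 S : bern_weight q S * (f S - a) = 0.
  apply: (@psumr_eq0P _ _ xpredT (fun S => bern_weight q S * (f S - a))) => //.
    by move=> i _; rewrite mulr_ge0 ?bern_weight_ge0 // subr_ge0 ltW.
  apply/eqP; rewrite eq_le sumr_ge0 ?andbT => [|i _].
    have <- : bern q f - bern q (fun=> a) = \sum_S bern_weight q S * (f S - a).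
      by rewrite -sumrB; apply: eq_bigr => S0 _; rewrite mulrBr.
    by rewrite bern_cst subr_le0.
  by rewrite mulr_ge0 ?bern_weight_ge0 // subr_ge0 ltW.
exfalso; have /eqP := bern_cst q (1 : R).
rewrite /bern big1 => [|S _]; first by rewrite eq_sym oner_eq0.
move/eqP: (w0 S); rewrite mulf_eq0 subr_eq0 (gt_eqF (fgt S)) orbF => /eqP ->.
by rewrite mul0r.
Qed.

Lemma prodr_if_set (S : {set T}) (a b : R) :
  \prod_i (if i \in S then a else b) = a ^+ #|S| * b ^+ #|~: S|.
Proof.
rewrite (bigID (mem S)) /= -!prodr_const; congr (_ * _).
  by apply: eq_bigr => i ->.
by apply: eq_big => i; rewrite ?inE // => /negbTE ->.
Qed.

Lemma prodr_ind (S : {set T}) (a : R) : \prod_i (if i \in S then a else 1) = a ^+ #|S|.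
Proof. by rewrite prodr_if_set expr1n mulr1. Qed.

Lemma natr_forall (P : pred T) : \prod_i (P i)%:R = [forall i, P i]%:R :> R.
Proof.
case: (boolP [forall i, P i]) => [/forallP Pi|].
  by rewrite big1 // => i _; rewrite Pi.
by rewrite negb_forall => /existsP[i /negbTE Pi]; rewrite (bigD1 i) //= Pi mul0r.
Qed.

Lemma bern_sub_disjoint (q : R) (S S' : {set T}) : [disjoint S & S'] ->
  bern q (fun G => ((S \subset G) && [disjoint S' & G])%:R) =
  q ^+ #|S| * (1 - q) ^+ #|S'|.
Proof.
move=> dS; rewrite -!prodr_ind -big_split /=.
(* The event is a condition on each element separately, so its indicator is a product. *)
transitivity (bern q (fun G => \prod_i
    (if i \in G then (i \notin S')%:R else (i \notin S)%:R))).
  apply: eq_bern => G.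
  transitivity ([forall i, if i \in G then i \notin S' else i \notin S]%:R : R).
    congr (nat_of_bool _)%:R; apply/andP/forallP.
      move=> [/subsetP SG]; rewrite disjoint_sym => /pred0P S'G i.
      case: ifP => iG; first by have := S'G i; rewrite /= iG => /negbT.
      by apply/negP => /SG; rewrite iG.
    move=> H; split; first apply/subsetP => i iS.
      by have := H i; case: ifP => //; rewrite iS.
    apply/pred0P => i /=; have := H i.
    by case: ifP; rewrite ?andbT ?andbF // => _ /negbTE.
  rewrite -natr_forall; apply: eq_bigr => i _; by case: ifP.
rewrite bern_prod; apply: eq_bigr => i _.
case: (boolP (i \in S)) => iS; case: (boolP (i \in S')) => iS' /=.
- by have /pred0P/(_ i) := dS; rewrite /= iS iS'.
- ring.
- ring.
- ring.
Qed.

Lemma bern_sub (q : R) (S : {set T}) :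
  bern q (fun G => (S \subset G)%:R) = q ^+ #|S|.
Proof.
have dS : [disjoint S & (set0 : {set T})].
  by rewrite disjoint_sym; apply/pred0P => i /=; rewrite inE.
have := bern_sub_disjoint q dS; rewrite cards0 mulr1 => <-.
apply: eq_bern => G; have -> : [disjoint (set0 : {set T}) & G].
  by apply/pred0P => i /=; rewrite inE.
by rewrite andbT.
Qed.

Lemma bern_disjoint (q : R) (S : {set T}) :
  bern q (fun G => ([disjoint S & G])%:R) = (1 - q) ^+ #|S|.
Proof.
have dS : [disjoint (set0 : {set T}) & S] by apply/pred0P => i /=; rewrite inE.
have := bern_sub_disjoint q dS; rewrite cards0 mul1r => <-.
by apply: eq_bern => G; rewrite sub0set.
Qed.

Lemma bern_expD (q a : R) (F : {set T}) :
  bern q (fun S => a ^+ #|F :\: S|) = (q + (1 - q) * a) ^+ #|F|.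
Proof.
rewrite -prodr_ind.
transitivity (bern q (fun S => \prod_i
   (if i \in S then 1 else if i \in F then a else 1))).
  apply: eq_bern => S; rewrite -prodr_ind; apply: eq_bigr => i _.
  by rewrite inE; case: (i \in S).
by rewrite bern_prod; apply: eq_bigr => i _; case: ifP => _; ring.
Qed.

End Bernoulli.

(** * The rounds of the random process and its expectation *)

Section Process.
Context {R : realType} {X C : finType}.
Variables (A B : C -> {set X}).

(* (G, V, W): the points kept initially, those of them still uncovered, and
   the blocks selected so far. *)
Definition state : Type := {set X} * {set X} * {set C}.

Implicit Types (s : state) (f g : state -> R) (S : {set X}) (Q : {set C}).

(** [B c] is tested against the initial set, not the uncovered one, because a selected copy must be
    induced in [G]. *)
Definition allowed s : {set C} :=
  [set c | (A c \subset s.1.2) && [disjoint B c & s.1.1]].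

Definition isolated Q : {set C} :=
  [set c in Q | [forall c' in Q, (c' != c) ==> [disjoint A c & A c']]].

(** Overlapping sampled blocks use up their points although they are not selected; so a set survives
    exactly when no allowed block touching it is sampled. *)
Definition step s Q : state :=
  (s.1.1, s.1.2 :\: \bigcup_(c in allowed s :&: Q) A c,
   s.2 :|: isolated (allowed s :&: Q)).

Variables (be q : R).

(** The last round is averaged first, conditionally on the state before it. *)
Fixpoint expect (t : nat) f : R :=
  if t is t'.+1 then expect t' (fun s => bern q (fun Q => f (step s Q)))
  else bern (1 - be) (fun G => f (G, G, set0)).

(** Invariant of the reachable states. Selected blocks lie among the covered points, which separates
    them from the blocks of later rounds. *)
Definition valid s : Prop :=
  [/\ s.1.2 \subset s.1.1,
      forall c, c \in s.2 -> A c \subset s.1.1 :\: s.1.2,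
      forall c, c \in s.2 -> [disjoint B c & s.1.1] &
      forall c c', c \in s.2 -> c' \in s.2 -> c != c' -> [disjoint A c & A c']].

Lemma valid0 G : valid (G, G, set0).
Proof. by split=> // [c|c|c c']; rewrite inE. Qed.

Lemma valid_step s Q : valid s -> valid (step s Q).
Proof.
move=> [VG AW BW dW]; set Q' := allowed s :&: Q.
have newP c : c \in isolated Q' -> [/\ A c \subset s.1.2, [disjoint B c & s.1.1],
    c \in Q' & forall c', c' \in Q' -> c' != c -> [disjoint A c & A c']].
  rewrite inE => /andP[cQ /forallP H]; have := cQ.
  rewrite {1}inE [_ \in allowed s]inE => /andP[/andP[sA dB] _].
  split=> // c' c'Q nc.
  by have /implyP/(_ c'Q)/implyP/(_ nc) := H c'.
have dis c c' : A c \subset s.1.1 :\: s.1.2 -> A c' \subset s.1.2 ->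
    [disjoint A c & A c'].
  move=> /subsetP Ac /subsetP Ac'; apply/pred0P => x /=; apply/andP => -[xc xc'].
  by have := Ac _ xc; rewrite inE (Ac' _ xc').
split=> /=.
- exact: subset_trans (subsetDl _ _) VG.
- move=> c; rewrite inE => /orP[/AW Ac|/newP[Ac _ cQ _]].
    by apply: (subset_trans Ac); apply: setDS; apply: subsetDl.
  rewrite subsetD (subset_trans Ac VG) /= disjoint_sym.
  apply/pred0P => x /=; apply/andP => -[+ xc].
  by rewrite inE => /andP[/bigcupP []]; exists c.
- by move=> c; rewrite inE => /orP[/BW|/newP[]].
- move=> c c'; rewrite !in_setU.
  move=> /orP[cW|/newP[Ac _ cQ dc]] /orP[c'W|/newP[Ac' _ c'Q dc']] nc.
  + exact: dW.
  + exact: dis (AW _ cW) Ac'.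
  + by rewrite disjoint_sym; apply: dis (AW _ c'W) Ac.
  + by apply: dc; rewrite // eq_sym.
Qed.

Hypotheses (be01 : 0 <= be <= 1) (q01 : 0 <= q <= 1).

Let be01' : 0 <= 1 - be <= 1.
Proof. by move: be01; lra. Qed.

Lemma eq_expect t f g : f =1 g -> expect t f = expect t g.
Proof.
elim: t f g => [|t IH] f g fg /=; first by apply: eq_bern => G.
by apply: IH => s; apply: eq_bern.
Qed.

Lemma ler_expect_valid t f g :
  (forall s, valid s -> f s <= g s) -> expect t f <= expect t g.
Proof.
elim: t f g => [|t IH] f g fg /=.
  by apply: ler_bern => // G; apply/fg/valid0.
by apply: IH => s vs; apply: ler_bern => // Q; apply/fg/valid_step.
Qed.

Lemma ler_expect t f g : (forall s, f s <= g s) -> expect t f <= expect t g.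
Proof. by move=> fg; apply: ler_expect_valid => s _. Qed.

Lemma expect_cst t a : expect t (fun=> a) = a.
Proof.
elim: t => [|t IH] /=; first exact: bern_cst.
by rewrite -[RHS]IH; apply: eq_expect => s; rewrite bern_cst.
Qed.

Lemma expectD t f g : expect t (fun s => f s + g s) = expect t f + expect t g.
Proof.
elim: t f g => [|t IH] f g /=; first exact: bernD.
by rewrite -IH; apply: eq_expect => s; rewrite bernD.
Qed.

Lemma expectZ t a f : expect t (fun s => a * f s) = a * expect t f.
Proof.
elim: t f => [|t IH] f /=; first exact: bernZ.
by rewrite -IH; apply: eq_expect => s; rewrite bernZ.
Qed.

Lemma expect_sum t (I : finType) (P : pred I) (F : I -> state -> R) :
  expect t (fun s => \sum_(i | P i) F i s) = \sum_(i | P i) expect t (F i).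
Proof.
elim: t F => [|t IH] F /=; first exact: bern_sum.
by rewrite -IH; apply: eq_expect => s; rewrite bern_sum.
Qed.

Lemma expect_ge0 t f : (forall s, 0 <= f s) -> 0 <= expect t f.
Proof. by move=> f0; rewrite -(expect_cst t 0); apply: ler_expect. Qed.

Lemma ler_norm_expect t f : `|expect t f| <= expect t (fun s => `|f s|).
Proof.
have H : expect t f <= expect t (fun s => `|f s|).
  by apply: ler_expect => s; apply: ler_norm.
rewrite ler_norml H andbT lerNl -mulN1r -expectZ.
by apply: ler_expect => s; rewrite mulN1r lerNl lerNnormlW.
Qed.

Lemma expect_le_ex t f a :
  expect t f <= a -> exists s, valid s /\ f s <= a.
Proof.
elim: t f => [|t IH] f /=.
  by move=> /(bern_le_ex be01')[G Ga]; exists (G, G, set0); split=> //; apply: valid0.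
move=> /IH[s [vs /(bern_le_ex q01)[Q fQ]]].
by exists (step s Q); split=> //; apply: valid_step.
Qed.

(* [a ^+ #|F :\: W|] interpolates between the indicator of [F \subset W], at
   a = 0, and 1; averaging it over one round turns a into q + (1 - q) a. *)
Lemma expect_sub t (F : {set C}) :
  expect t (fun s => (F \subset s.2)%:R) <= (t%:R * q) ^+ #|F|.
Proof.
have [q0 q1] := andP q01.
suff H a : 0 <= a <= 1 -> expect t (fun s => a ^+ #|F :\: s.2|) <= (t%:R * q + a) ^+ #|F|.
  have := H 0; rewrite lexx ler01 addr0 => /(_ isT); apply: le_trans.
  by apply: ler_expect => s; rewrite -setD_eq0 -cards_eq0 expr0n.
elim: t a => [|t IH] a a01 /=.
  rewrite mul0r add0r -[leRHS](@bern_cst R X (1 - be)).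
  by apply: ler_bern => // G /=; rewrite setD0.
have [a0 a1] := andP a01.
have qa : 0 <= q + (1 - q) * a <= 1 by apply/andP; split; nra.
apply: le_trans (le_trans (IH _ qa) _).
  apply: ler_expect => s; rewrite -bern_expD.
  apply: ler_bern => // Q; apply: ler_wiXn2l => //.
  rewrite setDDl; apply/subset_leq_card/setDS/setUS/subsetP => c.
  by rewrite inE => /andP[+ _]; rewrite inE => /andP[].
apply: lerXn2r; rewrite ?nnegrE.
- by rewrite addr_ge0 ?mulr_ge0 //; case/andP: qa.
- by rewrite addr_ge0 ?mulr_ge0.
- by rewrite -natr1; nra.
Qed.

End Process.

Lemma natr_card_set {R : realType} {T : finType} (P : pred T) :
  #|[set x | P x]|%:R = \sum_x (P x)%:R :> R.
Proof.
rewrite -sum1_card natr_sum big_mkcond /=; apply: eq_bigr => x _.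
by rewrite inE; case: (P x).
Qed.

Lemma natr_card {R : realType} {T : finType} (S : {set T}) :
  #|S|%:R = \sum_x (x \in S)%:R :> R.
Proof.
by rewrite -natr_card_set; congr (#|pred_of_set _|%:R); apply/setP => x; rewrite inE.
Qed.

Lemma leq_card_bigcup {I T : finType} (P : pred I) (F : I -> {set T}) :
  (#|\bigcup_(i | P i) F i| <= \sum_(i | P i) #|F i|)%N.
Proof.
elim/big_rec2: _ => [|i n S _ IH]; first by rewrite cards0.
by apply: leq_trans (leq_card_setU _ _) _; rewrite leq_add2l.
Qed.

(** * Tracking point sets through the process on a nearly regular system *)

Section Quasirandom.

(** The codegree also counts [y] in [B c], since both kinds of points carry conditions in the
    tracked events. [nr_large] absorbs a rounding error of one block into [ga * D]. *)
Record nearly_regular (R : realType) (X C : finType) (A B : C -> {set X})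
    (r b D : nat) (ga : R) : Prop := NearlyRegular {
  nr_cardA : forall c, #|A c| = r.+1;
  nr_cardB : forall c, #|B c| = b;
  nr_disjoint : forall c, [disjoint A c & B c];
  nr_degree : forall x, #|[set c | x \in A c]| = D;
  nr_codegree : forall x y, x != y ->
    #|[set c | (x \in A c) && (y \in A c :|: B c)]|%:R <= ga * D%:R;
  nr_large : 1 <= ga * D%:R
}.

Context {R : realType} {X C : finType}.
Variables (A B : C -> {set X}) (r b D : nat) (be q ga : R).
Hypothesis reg : nearly_regular A B r b D ga.
Hypotheses (be01 : 0 <= be <= 1) (q01 : 0 <= q <= 1).

Let cardA := nr_cardA reg.
Let cardB := nr_cardB reg.
Let disAB := nr_disjoint reg.
Let degA := nr_degree reg.
Let codegA := nr_codegree reg.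
Let ga_large := nr_large reg.

Notation state := (@state X C).
Implicit Types (s : state) (S : {set X}) (c : C).
Local Notation expect := (expect A B be q).
Local Notation allowed := (allowed A B).
Local Notation step := (step A B).

Let ga_ge0 : 0 <= ga.
Proof.
rewrite leNgt; apply/negP => ga0; have := ga_large; have D0 : 0 <= D%:R :> R by [].
by nra.
Qed.

Definition ind S (S' : {set X}) s : R := ((S \subset s.1.2) && [disjoint S' & s.1.1])%:R.

Definition touch S : {set C} := [set c | ~~ [disjoint A c & S]].

Definition load S s : nat := #|allowed s :&: touch S|.

Lemma ind_ge0 S S' s : 0 <= ind S (S' : {set X}) s. Proof. exact: ler0n. Qed.

Lemma ind_le1 S S' s : ind S (S' : {set X}) s <= 1. Proof. by rewrite lern1 leq_b1. Qed.

(** Survival means that none of the [load S s] allowed blocks touching [S] is sampled. *)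
Lemma ind_step S (S' : {set X}) s :
  bern q (fun Q => ind S S' (step s Q)) = ind S S' s * (1 - q) ^+ load S s.
Proof.
rewrite -bern_disjoint -bernZ; apply: eq_bern => Q.
rewrite /ind -natrM mulnb; congr (nat_of_bool _)%:R => /=.
rewrite subsetD -!andbA; congr (_ && _); rewrite andbC; congr (_ && _).
apply/pred0P/pred0P => /= H.
  move=> c /=; apply/andP => -[]; rewrite inE => /andP[ca]; rewrite inE => cS cQ.
  case/pred0Pn: cS => x /andP[/= xc xS]; have /negbT/negP := H x; rewrite /= xS /=; apply.
  by apply/bigcupP; exists c => //; rewrite inE ca.
move=> x /=; apply/andP => -[xS] /bigcupP[c]; rewrite inE => /andP[ca cQ] xc.
have /negbT/negP := H c; apply => /=; rewrite in_setI ca cQ andbT /= inE.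
by apply/pred0Pn; exists x; rewrite /= xc.
Qed.

(** Requiring a block to be allowed only enlarges the two sets, so the moments of [load] reduce to
    events of the same kind. *)
Lemma ind_allowed S (S' : {set X}) s c :
  ind S S' s * (c \in allowed s)%:R = ind (S :|: A c) (S' :|: B c) s.
Proof.
rewrite /ind -natrM mulnb; congr (nat_of_bool _)%:R.
rewrite inE subUset -!andbA; congr (_ && _); rewrite andbCA; congr (_ && _).
by rewrite -!setI_eq0 setIUl setU_eq0.
Qed.

Lemma ind_load S S' S0 s :
  ind S S' s * (load S0 s)%:R = \sum_(c in touch S0) ind (S :|: A c) (S' :|: B c) s.
Proof.
rewrite natr_card mulr_sumr [RHS]big_mkcond /=; apply: eq_bigr => c _.
by rewrite -ind_allowed inE; case: (c \in touch _); rewrite ?andbT ?andbF ?mulr0.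
Qed.

Lemma sum_degA S0 : \sum_(c in touch S0) #|A c :&: S0|%:R = #|S0|%:R * D%:R :> R.
Proof.
transitivity (\sum_c #|A c :&: S0|%:R : R).
  rewrite [RHS](bigID (mem (touch S0))) /= [X in _ = _ + X]big1 ?addr0 // => c.
  by rewrite inE negbK -setI_eq0 => /eqP ->; rewrite cards0.
under eq_bigr do rewrite natr_card.
rewrite exchange_big /= natr_card mulr_suml; apply: eq_bigr => x _.
rewrite -(degA x) natr_card_set mulr_sumr; apply: eq_bigr => c _.
by rewrite inE -mulnb natrM mulrC.
Qed.

(* Up to a proportion O(ga) of them, the blocks through S0 meet S in a single
   point, and hence are counted only once by the degrees of the points of S0. *)
Lemma sum_generic S0 S (w : C -> R) (tau de Z : R) :
  S0 \subset S -> 0 <= de -> 0 <= tau <= Z -> (forall c, 0 <= w c <= Z) ->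
  (forall c x, x \in A c -> x \in S0 -> (A c :|: B c) :&: S = [set x] ->
     `|w c - tau| <= de) ->
  `|\sum_(c in touch S0) w c - #|S0|%:R * D%:R * tau|
     <= #|S0|%:R * D%:R * (de + #|S|%:R * ga * Z).
Proof.
move=> S0S de0 /andP[tau0 tauZ] wZ Hgen; have Z0 : 0 <= Z := le_trans tau0 tauZ.
rewrite -sum_degA mulr_suml -sumrB; apply: le_trans (ler_norm_sum _ _ _) _.
(* [near x c] counts the other points of [S] in the block. It is at least 1 when the block meets [S]
   outside [x], and the codegrees bound its sum over the blocks through [x]. *)
pose near x c := \sum_(y in S :\ x) (y \in A c :|: B c)%:R : R.
have near_ge0 x c : 0 <= near x c by apply: sumr_ge0.
apply: (@le_trans _ _ (\sum_(c in touch S0) \sum_(x in A c :&: S0) (de + Z * near x c))).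
  apply: ler_sum => c; rewrite inE => /pred0Pn[x /andP[/= xc xS0]].
  have [w0 w1] := andP (wZ c).
  have xAS : x \in A c :&: S0 by rewrite inE xc.
  case: (boolP ((A c :|: B c) :&: S == [set x])) => [/eqP eqx|neqx].
    have -> : A c :&: S0 = [set x].
      apply/eqP; rewrite eqEsubset sub1set xAS andbT -eqx.
      by apply: setISS => //; apply: subsetUl.
    rewrite cards1 mul1r big_set1 (le_trans (Hgen _ _ xc xS0 eqx)) // lerDl.
    exact: mulr_ge0.
  apply: (@le_trans _ _ (#|A c :&: S0|%:R * Z)).
    have A1 : 1 <= #|A c :&: S0|%:R :> R.
      by rewrite ler1n card_gt0; apply/set0Pn; exists x.
    rewrite ler_norml; apply/andP; split; nra.
  rewrite -sumr_const mulr_suml big_mkcond [leRHS]big_mkcond; apply: ler_sum => y _ /=.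
  case: ifP => // yAS; rewrite mul1r.
  suff : 1 <= near y c by move=> H; nra.
  have [z [zS zy zAB]] : exists z, [/\ z \in S, z != y & z \in A c :|: B c].
    move: yAS; rewrite inE => /andP[yc yS0].
    case: (eqVneq y x) neqx => [-> neqx|yx _]; last first.
      by exists x; rewrite (subsetP S0S) // eq_sym yx inE xc.
    have : ~~ ((A c :|: B c) :&: S \subset [set x]).
      apply: contra neqx => sub1; rewrite eqEsubset sub1 sub1set !inE xc.
      by rewrite (subsetP S0S).
    move=> /subsetPn[z]; rewrite in_setI => /andP[zAB zS].
    by rewrite in_set1 => zx; exists z.
  rewrite /near (bigD1 z) /=; last by rewrite !inE zy.
  by rewrite zAB lerDl sumr_ge0.
apply: (@le_trans _ _ (\sum_(x in S0) \sum_(c | x \in A c) (de + Z * near x c))).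
  rewrite (exchange_big_dep (mem S0)) /= => [|c x _]; last by rewrite in_setI => /andP[].
  apply: ler_sum => x xS0; rewrite big_mkcond [leRHS]big_mkcond; apply: ler_sum => c _.
  rewrite !inE xS0 andbT; case: (x \in A c); rewrite ?andbF ?andbT //=.
  by case: ifP => // _; rewrite addr_ge0 // mulr_ge0.
rewrite sum_degA -[leRHS]mulrA -sumr_const mulr_suml.
rewrite [leRHS]big_mkcond [leLHS]big_mkcond; apply: ler_sum => x _ /=.
case: ifP => // xS0; rewrite mul1r big_split /= -mulr_sumr.
have -> : \sum_(c | x \in A c) de = D%:R * de.
  rewrite sumr_const mulr_natl -(degA x); congr (_ *+ _).
  by apply: eq_card => c; rewrite inE.
rewrite mulrDr lerD2l [leRHS](_ : _ = Z * (#|S|%:R * (ga * D%:R))); last by ring.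
apply: ler_wpM2l => //; rewrite /near exchange_big /=.
apply: (@le_trans _ _ (\sum_(y in S :\ x) ga * D%:R)).
  apply: ler_sum => y; rewrite !inE => /andP[yx _].
  rewrite eq_sym in yx; apply: le_trans (codegA yx); rewrite natr_card_set big_mkcond.
  by apply: ler_sum => c _; case: (x \in A c); rewrite !inE.
rewrite sumr_const -[leLHS]mulr_natl; apply: ler_wpM2r; first by rewrite mulr_ge0.
by rewrite ler_nat subset_leq_card // subsetDl.
Qed.

Lemma load_le S s : (load S s)%:R <= #|S|%:R * D%:R :> R.
Proof.
apply: (@le_trans _ _ #|touch S|%:R).
  by rewrite ler_nat subset_leq_card // subsetIr.
rewrite -sum_degA -sumr_const; apply: ler_sum => c.
by rewrite inE -setI_eq0 -card_gt0 ler1n.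
Qed.

(* A point is in about [D * surv t ^+ r * be ^+ b] allowed blocks; rounding up
   makes the survival probability of a round an integer power of 1 - q, which
   is compared with [(1 - q) ^+ load] without any exponential. *)
Fixpoint surv (t : nat) : R :=
  if t is t'.+1 then
    surv t' * (1 - q) ^+ (Num.trunc (D%:R * surv t' ^+ r * be ^+ b)).+1
  else 1 - be.

Lemma surv01 t : 0 <= surv t <= 1.
Proof.
elim: t => [|t /andP[s0 s1]] /=; first by move: be01; lra.
have Q0 : 0 <= 1 - q by move: q01; lra.
have Q1 : 1 - q <= 1 by move: q01; lra.
by rewrite mulr_ge0 ?exprn_ge0 //= mulr_ile1 ?exprn_ge0 ?exprn_ile1.
Qed.

Lemma monom01 t i j : 0 <= surv t ^+ i * be ^+ j <= 1.
Proof.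
have /andP[s0 s1] := surv01 t; have /andP[b0 b1] := be01.
by rewrite mulr_ge0 ?exprn_ge0 //= mulr_ile1 ?exprn_ge0 ?exprn_ile1.
Qed.

Definition approx t (sigma : nat) (de : R) : Prop :=
  forall S (S' : {set X}), [disjoint S & S'] -> (#|S| + #|S'| <= sigma)%N ->
  `|expect t (ind S S') - surv t ^+ #|S| * be ^+ #|S'| | <= de.

Lemma approx0 sigma de : 0 <= de -> approx 0 sigma de.
Proof.
move=> de0 S S' dS _ /=; rewrite bern_sub_disjoint //.
by rewrite [1 - (1 - be)](_ : _ = be) ?subrr ?normr0 //; ring.
Qed.

(** The shared point [x] is already in [S], so the block adds [r] of its [r.+1] points to [S], and
    all of [B c] to [S']. *)
Lemma generic_disjoint S (S' : {set X}) c x :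
  [disjoint S & S'] -> x \in S -> x \in A c ->
  (A c :|: B c) :&: (S :|: S') = [set x] ->
  [/\ [disjoint S :|: A c & S' :|: B c],
      #|S :|: A c| = (#|S| + r)%N & #|S' :|: B c| = (#|S'| + b)%N].
Proof.
move=> dS xS xA H.
have only y : (y \in A c) || (y \in B c) -> (y \in S) || (y \in S') -> y = x.
  by move=> y1 y2; apply/set1P; rewrite -H !inE y1 y2.
have disP (U V : {set X}) : (forall y, y \in U -> y \in V -> False) -> U :&: V = set0.
  move=> UV; apply/setP => y; rewrite !inE; apply/negbTE/negP => /andP[].
  exact: UV.
have xS' : x \in S' -> False by move=> h; have /pred0P/(_ x) := dS; rewrite /= xS h.
have xB : x \in B c -> False.
  by move=> h; have /pred0P/(_ x) := disAB c; rewrite /= xA h.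
have AS : A c :&: S' = set0.
  apply: disP => y yA yS; apply: xS'; rewrite -(only y) // ?yA //.
  by rewrite yS orbT.
have BS : B c :&: S = set0.
  by apply: disP => y yB yS; apply: xB; rewrite -(only y) // ?yS ?yB ?orbT.
have BS' : B c :&: S' = set0.
  by apply: disP => y yB yS; apply: xB; rewrite -(only y) // ?yS ?yB ?orbT.
have ASx : S :&: A c = [set x].
  apply/setP => y; rewrite !inE; apply/andP/eqP => [[yS yA]|->//].
  by apply: only; rewrite ?yA ?yS.
split.
- rewrite -setI_eq0 setIUr !setIUl AS (setIC S (B c)) BS !setU0 !set0U.
  by rewrite setU_eq0 !setI_eq0 dS disAB.
- by rewrite cardsU ASx cards1 cardA addnS subn1.
- by rewrite cardsU setIC BS' cards0 cardB subn0.
Qed.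

(** First moment: [ind_load] turns it into a sum of probabilities of enlarged events, and [approx]
    gives those of the generic blocks. *)
Lemma expect_load t S (S' S0 : {set X}) sigma de :
  approx t (sigma + (r.+1 + b)) de -> 0 <= de -> [disjoint S & S'] ->
  S0 \subset S -> (#|S| + #|S'| <= sigma)%N ->
  `|expect t (fun s => ind S S' s * (load S0 s)%:R)
    - #|S0|%:R * D%:R * (surv t ^+ (#|S| + r) * be ^+ (#|S'| + b))|
  <= #|S0|%:R * D%:R * (de + sigma%:R * ga).
Proof.
move=> ap de0 dS S0S Ssig; rewrite (eq_expect _ _ _ _ _ (ind_load S S' S0)) expect_sum.
apply: le_trans (sum_generic (S := S :|: S') (Z := 1) (de := de) _ _ _ _ _) _ => //.
- by rewrite (subset_trans S0S) // subsetUl.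
- exact: monom01.
- move=> c; rewrite (expect_ge0 _ _ be01 q01) => [|s]; rewrite ?ind_ge0 //=.
  by rewrite -(expect_cst A B be q t 1); apply: ler_expect => // s; apply: ind_le1.
- move=> c x xA xS0 H; have xS := subsetP S0S _ xS0.
  have [dd c1 c2] := generic_disjoint dS xS xA H.
  by rewrite -c1 -c2; apply: ap; rewrite // c1 c2 addnACA leq_add // leq_add2r.
rewrite mulr1; apply: ler_wpM2l; first by rewrite mulr_ge0.
rewrite lerD2l ler_wpM2r // ler_nat (leq_trans _ Ssig) //.
exact: leq_card_setU.
Qed.

(** One factor of the square is expanded over blocks and the other is estimated by [expect_load] for
    the enlarged event; hence room for two blocks in [approx]. *)
Lemma expect_load2 t S (S' S0 : {set X}) sigma de :
  approx t (sigma + (r.+1 + b) + (r.+1 + b)) de -> 0 <= de -> [disjoint S & S'] ->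
  S0 \subset S -> (#|S| + #|S'| <= sigma)%N ->
  `|expect t (fun s => ind S S' s * (load S0 s)%:R ^+ 2)
    - (#|S0|%:R * D%:R) ^+ 2 * (surv t ^+ (#|S| + r + r) * be ^+ (#|S'| + b + b))|
  <= (#|S0|%:R * D%:R) ^+ 2 * (de + (sigma + (r.+1 + b) + sigma)%:R * ga).
Proof.
move=> ap de0 dS S0S Ssig.
pose N : R := #|S0|%:R * D%:R; have N0 : 0 <= N by rewrite mulr_ge0.
pose w c := expect t (fun s => ind (S :|: A c) (S' :|: B c) s * (load S0 s)%:R).
have -> : expect t (fun s => ind S S' s * (load S0 s)%:R ^+ 2) = \sum_(c in touch S0) w c.
  rewrite /w -expect_sum //; apply: eq_expect => s.
  by rewrite expr2 mulrA ind_load mulr_suml.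
have /andP[m0 m1] := monom01 t (#|S| + r + r) (#|S'| + b + b).
set tau := N * (surv t ^+ (#|S| + r + r) * be ^+ (#|S'| + b + b)).
set de' := N * (de + (sigma + (r.+1 + b))%:R * ga).
have := @sum_generic S0 (S :|: S') w tau de' N.
rewrite -/N => H; apply: le_trans (le_trans (H _ _ _ _ _) _).
- by rewrite /tau expr2 !mulrA.
- by rewrite (subset_trans S0S) // subsetUl.
- by rewrite mulr_ge0 // addr_ge0 // mulr_ge0.
- by rewrite /tau mulr_ge0 //= ler_piMr.
- move=> c; rewrite (expect_ge0 _ _ be01 q01) => [|s]; rewrite ?mulr_ge0 ?ind_ge0 //=.
  rewrite -(expect_cst A B be q t N); apply: ler_expect => // s.
  by rewrite -[leRHS]mul1r ler_pM ?ind_ge0 ?ind_le1 ?load_le.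
- move=> c x xA xS0 gen; have xS := subsetP S0S _ xS0.
  have [dd c1 c2] := generic_disjoint dS xS xA gen.
  rewrite /tau -c1 -c2; apply: expect_load => //.
    by rewrite (subset_trans S0S) // subsetUl.
  by rewrite c1 c2 addnACA leq_add // leq_add2r.
rewrite /de' expr2 -[leRHS]mulrA; apply: ler_wpM2l => //.
have SU : #|S :|: S'|%:R <= sigma%:R :> R.
  by rewrite ler_nat (leq_trans _ Ssig) // leq_card_setU.
rewrite [in leRHS]natrD mulrDl addrA [leRHS]mulrDr lerD2l [N * _]mulrC.
by rewrite !ler_wpM2r.
Qed.

(** When the square is expanded, the three main terms are [y * z ^+ 2] with coefficients 1, -2 and
    1, up to a common factor. They cancel, and only the errors of the moments remain. *)
Lemma expect_load_variance t S (S' : {set X}) sigma de :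
  approx t (sigma + (r.+1 + b) + (r.+1 + b)) de -> 0 <= de -> [disjoint S & S'] ->
  (#|S| + #|S'| <= sigma)%N ->
  expect t (fun s => ind S S' s *
     ((load S s)%:R - #|S|%:R * (D%:R * surv t ^+ r * be ^+ b)) ^+ 2)
  <= (#|S|%:R * D%:R) ^+ 2 * (4 * (de + (sigma + (r.+1 + b))%:R * ga)).
Proof.
move=> ap de0 dS Ssig; set rho := (r.+1 + b)%N in ap *.
have sub k : (k <= sigma + rho + rho)%N -> approx t k de.
  by move=> ksig U V dU Uk; apply: ap => //; apply: leq_trans Uk ksig.
have H0 := ap S S' dS (leq_trans Ssig (leq_trans (leq_addr rho _) (leq_addr rho _))).
have H1 := expect_load (sub _ (leq_addr rho _)) de0 dS (subxx S) Ssig.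
have H2 := expect_load2 ap de0 dS (subxx S) Ssig.
pose N : R := #|S|%:R * D%:R; have N0 : 0 <= N by rewrite mulr_ge0.
rewrite -/N in H1 H2 *.
pose z := surv t ^+ r * be ^+ b; have /andP[z0 z1] : 0 <= z <= 1 by apply: monom01.
pose y := surv t ^+ #|S| * be ^+ #|S'|.
have E1 : surv t ^+ (#|S| + r) * be ^+ (#|S'| + b) = y * z.
  by rewrite !exprD /y /z; ring.
have E2 : surv t ^+ (#|S| + r + r) * be ^+ (#|S'| + b + b) = y * z ^+ 2.
  by rewrite !exprD /y /z; ring.
rewrite E1 in H1; rewrite E2 in H2; rewrite -/y in H0.
have -> : expect t (fun s => ind S S' s *
     ((load S s)%:R - #|S|%:R * (D%:R * surv t ^+ r * be ^+ b)) ^+ 2) =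
  expect t (fun s => ind S S' s * (load S s)%:R ^+ 2)
  + (- (2 * (N * z))) * expect t (fun s => ind S S' s * (load S s)%:R)
  + (N * z) ^+ 2 * expect t (ind S S').
  rewrite -!expectZ -!expectD; apply: eq_expect => s.
  by rewrite /N /z; ring.
move: H0 H1 H2; set x0 := expect _ _; set x1 := expect _ _; set x2 := expect _ _.
set u := sigma%:R * ga; rewrite !natrD !mulrDl -/u.
set v := (r.+1 + b)%:R * ga.
have u0 : 0 <= u by apply: mulr_ge0.
have v0 : 0 <= v by apply: mulr_ge0.
have vE : v = r.+1%:R * ga + b%:R * ga by rewrite /v natrD mulrDl.
rewrite !ler_norml => /andP[_ h0] /andP[h1 _] /andP[_ h2].
have Nz : 0 <= N * z by apply: mulr_ge0.
have k0 : (N * z) ^+ 2 * x0 <= (N * z) ^+ 2 * y + N ^+ 2 * de.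
  rewrite -lerBlDl -mulrBr exprMn -mulrA; apply: ler_wpM2l; first exact: exprn_ge0.
  apply: le_trans (ler_wpM2l (exprn_ge0 2 z0) h0) _.
  by rewrite ler_piMl // exprn_ile1.
have k1 : - (2 * (N * z)) * x1 <= - (2 * (N * z)) * (N * (y * z)) + 2 * N ^+ 2 * (de + u).
  have := ler_wpM2l Nz h1; have : N * z * (N * (de + u)) <= N ^+ 2 * (de + u).
    rewrite [leLHS](_ : _ = z * (N ^+ 2 * (de + u))); last by ring.
    by rewrite ler_piMl // mulr_ge0 ?exprn_ge0 // addr_ge0.
  by nra.
have k2 : 0 <= N ^+ 2 * v by rewrite mulr_ge0 ?exprn_ge0.
have k3 : 0 <= N ^+ 2 * u by rewrite mulr_ge0 ?exprn_ge0.
rewrite -vE; rewrite -vE in h2; clear -h2 k0 k1 k2 k3.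
by nra.
Qed.

(** * One round: propagation of the estimate and decay of the survival probability *)

Lemma bernoulli_ineq (a : R) k : 0 <= a <= 1 -> 1 - k%:R * a <= (1 - a) ^+ k.
Proof.
move=> /andP[a0 a1]; elim: k => [|k IH]; first by rewrite mul0r subr0.
have k0 : 0 <= k%:R :> R by [].
rewrite exprS -natr1; have := ler_wpM2l (_ : 0 <= 1 - a) IH.
by rewrite subr_ge0 => /(_ a1); nra.
Qed.

Lemma expr1B_lipschitz (a : R) i j : 0 <= a <= 1 ->
  `|(1 - a) ^+ i - (1 - a) ^+ j| <= a * `|i%:R - j%:R|.
Proof.
move=> a01; have /andP[a0 a1] := a01.
wlog ij : i j / (i <= j)%N.
  by move=> H; case/orP: (leq_total i j) => /H //; rewrite distrC [`|j%:R - _|]distrC.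
rewrite -(subnKC ij) exprD natrD opprD addrA subrr sub0r normrN normr_nat.
have p0 k : 0 <= (1 - a) ^+ k by rewrite exprn_ge0 // subr_ge0.
have p1 k : (1 - a) ^+ k <= 1 by rewrite exprn_ile1 ?subr_ge0 // lerBlDr lerDl.
rewrite -{1}[(1 - a) ^+ i]mulr1 -mulrBr ger0_norm ?mulr_ge0 ?subr_ge0 //.
have B1 := bernoulli_ineq (j - i) a01.
apply: (@le_trans _ _ (1 - (1 - a) ^+ (j - i))).
  by rewrite ler_piMl // subr_ge0.
by rewrite lerBlDl -lerBlDr mulrC.
Qed.

(** Replacing [(1 - q) ^+ load] by the deterministic [Qm] costs at most [q] times the deviation of
    the load, plus rounding, and the variance bounds this on average. The parameter [la] is free, to
    be optimised later. *)
Lemma approxS t sigma de la :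
  approx t (sigma + (r.+1 + b) + (r.+1 + b)) de -> 0 <= de -> 0 < la ->
  approx t.+1 sigma (de + q * D%:R *
    (la + sigma%:R * ga
     + sigma%:R ^+ 2 * (4 * (de + (sigma + (r.+1 + b))%:R * ga)) / la)).
Proof.
move=> ap de0 la0 S S' dS Ssig.
have D0 : 0 < D%:R :> R.
  rewrite lt0r ler0n andbT; apply/negP => /eqP D0.
  by move: ga_large; rewrite D0 mulr0 ler10.
have laD : 0 < la * D%:R by apply: mulr_gt0.
have [q0 q1] := andP q01.
set mu := D%:R * surv t ^+ r * be ^+ b.
have mu0 : 0 <= mu.
  by rewrite /mu -mulrA mulr_ge0 //; case/andP: (monom01 t r b).
set M := (Num.trunc mu).+1.
have HM : `|M%:R - mu| <= 1.
  have /andP[m1 m2] := truncn_itv mu0.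
  rewrite ger0_norm ?subr_ge0 ?(ltW m2) // /M -natr1; move: m1.
  by lra.
pose y := surv t ^+ #|S| * be ^+ #|S'|.
set Qm := (1 - q) ^+ (M * #|S|).
have Qm0 : 0 <= Qm by rewrite exprn_ge0 // subr_ge0.
have Qm1 : Qm <= 1 by rewrite exprn_ile1 ?subr_ge0 // lerBlDr lerDl.
have -> : surv t.+1 ^+ #|S| * be ^+ #|S'| = Qm * y.
  by rewrite /= -/mu -/M exprMn -exprM /Qm /y; ring.
have -> : expect t.+1 (ind S S') =
    expect t (fun s => ind S S' s * ((1 - q) ^+ load S s - Qm))
    + Qm * expect t (ind S S').
  rewrite -expectZ -expectD /=; apply: eq_expect => s; rewrite ind_step.
  by ring.
rewrite -addrA -mulrBr addrC; apply: le_trans (ler_normD _ _) _; apply: lerD.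
  rewrite normrM ger0_norm //.
  have H : `|expect t (ind S S') - y| <= de.
    by apply: ap => //; rewrite -addnA (leq_trans Ssig) // leq_addr.
  by apply: le_trans H; rewrite ler_piMl.
apply: le_trans (ler_norm_expect _ _ be01 q01 _ _) _.
pose var s := ind S S' s * ((load S s)%:R - #|S|%:R * mu) ^+ 2.
have pointwise s : `|ind S S' s * ((1 - q) ^+ load S s - Qm)|
    <= q * (la * D%:R + #|S|%:R) + q / (la * D%:R) * var s.
  rewrite normrM ger0_norm ?ind_ge0 //.
  set z := (load S s)%:R - #|S|%:R * mu.
  (* This replaces Chebyshev: it bounds the mean deviation by the variance without a split into
     cases. *)
  have zla : `|z| <= la * D%:R + z ^+ 2 / (la * D%:R).
    have : `|z| * (la * D%:R) <= (la * D%:R) ^+ 2 + z ^+ 2.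
      rewrite -(real_normK (num_real z)); have := normr_ge0 z.
      by move: laD; set u := `|z|; set v := la * _; nra.
    by rewrite -ler_pdivlMr // => /le_trans; apply; rewrite mulrDl expr2 mulfK ?gt_eqF.
  have L : `|(1 - q) ^+ load S s - Qm|
      <= q * (la * D%:R + #|S|%:R + z ^+ 2 / (la * D%:R)).
    apply: le_trans (expr1B_lipschitz _ _ q01) _; apply: ler_wpM2l => //.
    have -> : (load S s)%:R - (M * #|S|)%:R = z - (M%:R - mu) * #|S|%:R.
      by rewrite natrM /z; ring.
    apply: le_trans (ler_normB _ _) _; rewrite addrAC; apply: lerD => //.
    by rewrite normrM normr_nat ler_piMl.
  rewrite /var -/z; have i0 := ind_ge0 S S' s; have i1 := ind_le1 S S' s.
  apply: le_trans (ler_wpM2l i0 L) _; rewrite [q * _]mulrDr mulrDr; apply: lerD.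
    by rewrite ler_piMl // mulr_ge0 // addr_ge0 // ltW.
  rewrite le_eqVlt; apply/orP; left; apply/eqP; ring.
apply: le_trans (ler_expect _ _ be01 q01 _ pointwise) _.
rewrite expectD expect_cst expectZ.
have V := expect_load_variance ap de0 dS Ssig; rewrite -/mu -/var in V.
have Ss : #|S|%:R <= sigma%:R :> R.
  by rewrite ler_nat (leq_trans _ Ssig) // leq_addr.
have iq : 0 <= q / (la * D%:R) by rewrite divr_ge0 // ltW.
apply: le_trans (lerD (lexx _) (ler_wpM2l iq V)) _.
set K := 4 * _; have K0 : 0 <= K.
  by rewrite mulr_ge0 // addr_ge0 // mulr_ge0.
rewrite [leRHS]mulrDr; apply: lerD.
  rewrite -mulrA; apply: ler_wpM2l => //.
  have : sigma%:R * 1 <= sigma%:R * (ga * D%:R) by apply: ler_wpM2l.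
  by move: Ss; set s1 := #|S|%:R; set s2 := sigma%:R; lra.
have -> : q / (la * D%:R) * ((#|S|%:R * D%:R) ^+ 2 * K) =
    q * D%:R * (#|S|%:R ^+ 2 * K / la).
  by field; rewrite !gt_eqF.
apply: ler_wpM2l; first exact: mulr_ge0.
apply: ler_wpM2r; first by rewrite invr_ge0 ltW.
by apply: ler_wpM2r => //; apply: lerXn2r; rewrite ?nnegrE.
Qed.

(** While the survival probability exceeds [eta], its exponent [M] satisfies [q * M >= g], so a
    round divides it by at least [1 + g]; and [(1 + g) * (1 + t * g)] is at least
    [1 + (t + 1) * g]. *)
Lemma surv_small (eta : R) t : 0 < eta ->
  surv t <= eta \/ surv t * (1 + t%:R * (q * D%:R * eta ^+ r * be ^+ b)) <= 1.
Proof.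
move=> eta0; have [q0 q1] := andP q01; have [be0 be1] := andP be01.
set g := q * D%:R * eta ^+ r * be ^+ b.
have g0 : 0 <= g by rewrite !mulr_ge0 ?exprn_ge0 // ltW.
have pow k : (1 - q) ^+ k * (1 + q * k%:R) <= 1.
  elim: k => [|k IH]; first by rewrite mulr0 addr0 mulr1.
  have p0 : 0 <= (1 - q) ^+ k by rewrite exprn_ge0 // subr_ge0.
  have k0 : 0 <= k%:R :> R by [].
  apply: le_trans IH; rewrite exprS [(1 - q) * _]mulrC -mulrA; apply: ler_wpM2l => //.
  by rewrite -natr1; nra.
elim: t => [|t [IH|IH]].
- by right; rewrite mul0r addr0 mulr1; case/andP: (surv01 0).
- left; apply: le_trans IH; rewrite /= ler_piMr //; first by case/andP: (surv01 t).
  by rewrite exprn_ile1 ?subr_ge0 // lerBlDr lerDl.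
- have [|lt_eta] := leP (surv t.+1) eta; [by left | right].
  have [s0 s1] := andP (surv01 t); have [s0' s1'] := andP (surv01 t.+1).
  move: lt_eta s0' s1' => /=; set mu := _ * _ * be ^+ b.
  set M := (Num.trunc mu).+1; set P := (1 - q) ^+ M => lt_eta s0' s1'.
  have P0 : 0 <= P by rewrite exprn_ge0 // subr_ge0.
  have P1 : P <= 1 by rewrite exprn_ile1 ?subr_ge0 // lerBlDr lerDl.
  have eta_s : eta <= surv t.
    by apply: ltW; apply: lt_le_trans lt_eta _; rewrite ler_piMr.
  have mu0 : 0 <= mu.
    by rewrite /mu -mulrA mulr_ge0 //; case/andP: (monom01 t r b).
  have gM : g <= q * M%:R.
    rewrite /g -!mulrA; apply: ler_wpM2l => //.
    apply: le_trans (ltW (proj2 (andP (truncn_itv mu0)))).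
    rewrite /mu -mulrA; apply: ler_wpM2l => //; apply: ler_wpM2r; first exact: exprn_ge0.
    by apply: lerXn2r; rewrite ?nnegrE // ltW.
  have Pg : P * (1 + g) <= 1.
    by apply: le_trans (pow M); apply: ler_wpM2l => //; rewrite lerD2l.
  apply: le_trans IH; rewrite -mulrA; apply: ler_wpM2l => //.
  have t0 : 0 <= t%:R :> R by [].
  rewrite -natr1; apply: (@le_trans _ _ (P * (1 + g) * (1 + t%:R * g))); last first.
    by rewrite ler_piMl // addr_ge0 // mulr_ge0.
  rewrite -mulrA; apply: ler_wpM2l => //.
  move: (mulr_ge0 (mulr_ge0 t0 g0) g0). nra.
Qed.

(* In a valid state, the number of covered points outside all selected blocks:
   those lost because two blocks of the same round overlapped. *)
Definition waste s : R := #|s.1.1 :\: s.1.2|%:R - r.+1%:R * #|s.2|%:R.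

(** Ordered pairs, so that each sampled allowed block that is not isolated is the first component of
    one. *)
Definition clash : {set C * C} :=
  [set p | (p.1 != p.2) && ~~ [disjoint A p.1 & A p.2]].

Lemma card_clash : (#|clash| <= #|X| * D ^ 2)%N.
Proof.
rewrite -(ler_nat R) natr_card natrM natrX.
apply: (@le_trans _ _ (\sum_(p : C * C) \sum_x (x \in A p.1)%:R * (x \in A p.2)%:R)).
  apply: ler_sum => p _; rewrite inE.
  case: (boolP (_ && _)) => [/andP[_ /pred0Pn[x /andP[/= x1 x2]]]|_]; last first.
    by apply: sumr_ge0 => x _; rewrite -natrM.
  rewrite (bigD1 x) //= x1 x2 mulr1 lerDl.
  by apply: sumr_ge0 => z _; rewrite -natrM.
rewrite exchange_big /= -sum1_card natr_sum mulr_suml; apply: ler_sum => x _.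
rewrite mul1r -(pair_bigA _ (fun c c' => (x \in A c)%:R * (x \in A c')%:R)) /=.
under eq_bigr do rewrite -mulr_sumr -natr_card_set degA.
by rewrite -mulr_suml -natr_card_set degA expr2.
Qed.

(** A round covers at most [r.+1] points per sampled allowed block, and fails to select at most one
    such block per sampled clash. *)
Lemma waste_step s Q : valid A B s ->
  waste (step s Q) <= waste s
    + r.+1%:R * \sum_(p in clash) ([set p.1; p.2] \subset Q)%:R.
Proof.
move=> vs; rewrite /waste /=; set Q' := allowed s :&: Q.
have [VG AW _ _] := vs.
have cover1 : (#|s.1.1 :\: (s.1.2 :\: \bigcup_(c in Q') A c)|
    <= #|s.1.1 :\: s.1.2| + r.+1 * #|Q'|)%N.
  rewrite setDDr; apply: leq_trans (leq_card_setU _ _) _; rewrite leq_add2l.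
  apply: leq_trans (subset_leq_card (subsetIr _ _)) _.
  apply: leq_trans (leq_card_bigcup _ _) _.
  by rewrite (eq_bigr (fun=> r.+1)) // sum_nat_const mulnC.
have cardW : #|s.2 :|: isolated A Q'| = (#|s.2| + #|isolated A Q'|)%N.
  rewrite cardsU (_ : _ :&: _ = set0) ?cards0 ?subn0 //; apply/setP => c.
  rewrite in_setI in_set0; apply/andP => -[/AW Ac]; rewrite inE => /andP[+ _].
  rewrite inE => /andP[+ _]; rewrite inE => /andP[Ac' _].
  have /card_gt0P[x xc] : (0 < #|A c|)%N by rewrite cardA.
  by have := subsetP Ac _ xc; rewrite inE (subsetP Ac' _ xc).
pose N := #|[set p in clash | [set p.1; p.2] \subset Q]|.
have cardQ : (#|Q'| <= #|isolated A Q'| + N)%N.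
  rewrite -(cardsID (isolated A Q') Q') leq_add //.
    by rewrite subset_leq_card // subsetIr.
  apply: leq_trans (leq_imset_card fst _); apply: subset_leq_card.
  apply/subsetP => c; rewrite in_setD [c \in isolated _ _]inE => /andP[+ cQ].
  rewrite cQ /= => /forallPn[c']; rewrite negb_imply => /andP[c'Q].
  rewrite negb_imply => /andP[nc dis].
  apply/imsetP; exists (c, c') => //; rewrite !inE /= eq_sym nc dis /=.
  move: cQ c'Q; rewrite !in_setI => /andP[_ cQ] /andP[_ c'Q].
  by rewrite subUset !sub1set cQ.
have -> : \sum_(p in clash) ([set p.1; p.2] \subset Q)%:R = N%:R :> R.
  rewrite /N natr_card_set big_mkcond /=; apply: eq_bigr => p _.
  by case: (p \in clash).
rewrite cardW natrD.
have : #|s.1.1 :\: (s.1.2 :\: \bigcup_(c in Q') A c)|%:R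
    <= #|s.1.1 :\: s.1.2|%:R + r.+1%:R * (#|isolated A Q'|%:R + N%:R) :> R.
  rewrite -!(natrD, natrM) ler_nat; apply: leq_trans cover1 _.
  by rewrite leq_add2l leq_mul2l cardQ orbT.
by move: (r.+1%:R : R) => r1; nra.
Qed.

(** A clash is sampled with probability [q ^+ 2]. Once [q * D = L / T], the total over [T] rounds is
    a proportion O(L^2 / T) of the points. *)
Lemma expect_waste t :
  expect t waste <= t%:R * (r.+1%:R * (#|X|%:R * (q * D%:R) ^+ 2)).
Proof.
elim: t => [|t IH].
  rewrite mul0r /= -[leRHS](@bern_cst R X (1 - be)).
  apply: ler_bern => [|G]; first by move: be01; lra.
  by rewrite /waste /= setDv !cards0 mulr0 subr0.
rewrite -natr1 mulrDl mul1r; set K := r.+1%:R * _ in IH *.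
apply: (@le_trans _ _ (expect t (fun s => waste s + K))).
  apply: (@ler_expect_valid R X C A B be q be01 q01 t) => s vs.
  rewrite -[leRHS](@bern_cst R C q).
  apply: le_trans (ler_bern q01 (fun Q => waste_step Q vs)) _.
  rewrite bernD bernZ bern_sum !bern_cst lerD2l ler_wpM2l //.
  rewrite (eq_bigr (fun=> q ^+ 2)) => [|p]; last first.
    by rewrite inE bern_sub cards2 => /andP[-> _].
  rewrite sumr_const -[leLHS]mulr_natl exprMn [leRHS]mulrCA [leLHS]mulrC.
  apply: ler_wpM2l; first by rewrite exprn_ge0 //; case/andP: q01.
  by rewrite -natrX -natrM ler_nat card_clash.
by rewrite expectD expect_cst lerD2r.
Qed.

End Quasirandom.

(** * Choice of the constants and the nibble with conflicts *)

Lemma approx_small {R : realType} (r b : nat) (be L : R) t sigma (de : R) :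
  0 <= be <= 1 -> 0 <= L -> 0 < de ->
  exists2 ga0 : R, 0 < ga0 & forall (X C : finType) (A B : C -> {set X}) D q ga,
    nearly_regular A B r b D ga -> ga <= ga0 -> 0 <= q <= 1 -> q * D%:R <= L ->
    approx A B r b D be q t sigma de.
Proof.
move=> be01 L0; elim: t sigma de => [|t IH] sigma de de0.
  exists 1 => // X C A B D q ga _ _ _ _; apply: approx0; exact: ltW.
pose rho := (r.+1 + b)%N; pose sR : R := sigma%:R.
have sR0 : 0 <= sR by apply: ler0n.
(* [la], then [de1], then [ga2] are chosen so that each of the three parts of the error in [approxS]
   is at most [de / 4]. *)
pose la := de / (4 * (1 + L)).
have L1 : 0 < 1 + L by lra.
have la0 : 0 < la by rewrite divr_gt0 // mulr_gt0.
pose K := 4 * sR ^+ 2 / la.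
have K0 : 0 <= K by apply: divr_ge0; [apply: mulr_ge0 => //; apply: exprn_ge0|exact: ltW].
have LK : 0 <= L * K by rewrite mulr_ge0.
pose de1 := de / (4 * (1 + L * K)).
have de10 : 0 < de1 by rewrite divr_gt0 // mulr_gt0 //; lra.
have [ga1 ga10 H1] := IH (sigma + rho + rho)%N de1 de10.
pose Z := L * (sR + K * (sigma + rho)%:R).
have Z0 : 0 <= Z by apply: mulr_ge0 => //; apply: addr_ge0 => //; apply: mulr_ge0.
pose ga2 := de / (4 * (1 + Z)).
have ga20 : 0 < ga2 by rewrite divr_gt0 // mulr_gt0 //; lra.
exists (Num.min ga1 ga2); first by rewrite lt_min ga10.
move=> X C A B D q ga reg; rewrite le_min => /andP[gaga1 gaga2] q01 qD.
have ap := H1 _ _ _ _ _ _ _ reg gaga1 q01 qD.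
have ga0 : 0 <= ga.
  rewrite leNgt; apply/negP => gaN; have D0 : 0 <= D%:R :> R by [].
  by have := nr_large reg; nra.
have step := approxS reg be01 q01 ap (ltW de10) la0.
move=> S S' dS Ssig; apply: le_trans (step S S' dS Ssig) _.
rewrite -/rho -/sR; set inner := (X in q * _ * X).
have inner0 : 0 <= inner.
  have k : 0 <= (sigma + rho)%:R * ga by rewrite mulr_ge0.
  apply: addr_ge0; first by apply: addr_ge0; [exact: ltW|exact: mulr_ge0].
  apply: divr_ge0; last exact: ltW.
  by apply: mulr_ge0; [exact: exprn_ge0|rewrite mulr_ge0 // addr_ge0 // ltW].
apply: le_trans (lerD (lexx _) (ler_wpM2r inner0 qD)) _.
have -> : L * inner = L * la + de1 * (L * K) + Z * ga.
  by rewrite /inner /Z /K; field; rewrite gt_eqF.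
have e1 : L * la <= de / 4.
  have : la * (1 + L) = de / 4 by rewrite /la; field; rewrite gt_eqF.
  by nra.
have e2 : de1 * (1 + L * K) = de / 4 by rewrite /de1; field; rewrite gt_eqF //; lra.
have e3 : ga2 * (1 + Z) = de / 4 by rewrite /ga2; field; rewrite gt_eqF //; lra.
have e4 : Z * ga <= Z * ga2 by apply: ler_wpM2l.
by nra.
Qed.

(** [(K / D) ^+ #|F|] bounds the probability that the conflict [F] is selected, and [#|F|] is the
    cost of deleting all its blocks. *)
Theorem nibble {R : realType} (r b : nat) (eta : R) : 0 < eta ->
  exists K ga : R, [/\ 0 < K, 0 < ga &
  forall (X C : finType) (A B : C -> {set X}) (D : nat) (conf : {set {set C}}),
    nearly_regular A B r b D ga -> set0 \notin conf ->
    \sum_(F in conf) #|F|%:R * (K / D%:R) ^+ #|F| <= ga * #|X|%:R ->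
  exists (G : {set X}) (M : {set C}),
    [/\ forall c, c \in M -> A c \subset G /\ [disjoint B c & G],
        forall c c', c \in M -> c' \in M -> c != c' -> [disjoint A c & A c'],
        forall F, F \in conf -> ~~ (F \subset M) &
        (1 - eta) * #|X|%:R <= r.+1%:R * #|M|%:R]].
Proof.
(* The losses will be [2 * e], [2 * e], [e] and [e] times [#|X|]: points outside [G], uncovered
   points, waste and deleted blocks. The same [e] serves as [be]. *)
move=> eta0; pose e : R := Num.min eta 1 / 6.
have e0 : 0 < e by rewrite divr_gt0 // lt_min eta0 ltr01.
have e1 : e <= 1.
  have : Num.min eta 1 <= 1 by rewrite ge_min lexx orbT.
  rewrite /e; lra.
have e_eta : 6 * e <= eta.
  have : Num.min eta 1 <= eta by rewrite ge_min lexx.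
  rewrite /e; lra.
clearbody e.
have be01 : 0 <= e <= 1 by rewrite ltW.
pose g0 := e ^+ r * e ^+ b; have g00 : 0 < g0 by rewrite mulr_gt0 // exprn_gt0.
(* This value makes the second alternative of [surv_small] read [surv * (1 + e^-1) <= 1]. *)
pose L := (e * g0)^-1; have L0 : 0 < L by rewrite invr_gt0 mulr_gt0.
(* With more than [Z] rounds, the first summand gives [q <= 1] and the second brings the waste below
   [e * #|X|]. *)
pose Z := L + r.+1%:R * L ^+ 2 / e.
have rL0 : 0 <= r.+1%:R * L ^+ 2 / e.
  by apply: divr_ge0; [apply: mulr_ge0 => //; apply: exprn_ge0|]; exact: ltW.
have Z0 : 0 <= Z by apply: addr_ge0; first exact: ltW.
pose T := (Num.trunc Z).+1; have ZT : Z < T%:R by case/andP: (truncn_itv Z0).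
have T1 : 1 <= T%:R :> R by rewrite ler1n.
have T0 : 0 < T%:R :> R by rewrite ltr0n.
(* In the end only single points are tracked, hence the size bound 1. *)
have [ga0 ga00 Happ] := @approx_small R r b e L T 1 e be01 (ltW L0) e0.
have r0 : 0 < r.+1%:R :> R by rewrite ltr0n.
pose ga := Num.min ga0 (e / r.+1%:R).
have ga_gt0 : 0 < ga by rewrite lt_min ga00 divr_gt0.
exists L, ga; split=> // X C A B D conf reg conf0 Hconf.
have D1 : 1 <= D%:R :> R.
  rewrite ler1n lt0n; apply/negP => /eqP D0.
  by have := nr_large reg; rewrite D0 mulr0 ler10.
have D0 : 0 < D%:R :> R by apply: lt_le_trans D1.
pose q := L / (T%:R * D%:R).
have LT : L <= T%:R by apply: le_trans (ltW ZT); rewrite lerDl.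
have qD : q * D%:R = L / T%:R by rewrite /q; field; rewrite !gt_eqF.
have Tq : T%:R * q = L / D%:R by rewrite /q; field; rewrite !gt_eqF.
have q01 : 0 <= q <= 1.
  apply/andP; split; first by apply: divr_ge0; [exact: ltW|exact: mulr_ge0].
  by rewrite ler_pdivrMr ?mulr_gt0 // mul1r (le_trans LT) // ler_peMr // ltW.
have qDL : q * D%:R <= L by rewrite qD ler_pdivrMr // ler_peMr // ltW.
have gaga0 : ga <= ga0 by rewrite ge_min lexx.
have app := Happ _ _ _ _ _ _ _ reg gaga0 q01 qDL.
pose E := expect A B e q T.
have survT : surv r b D e q T <= e.
  have [//|] := surv_small r b D be01 q01 T e0.
  have -> : T%:R * (q * D%:R * e ^+ r * e ^+ b) = e^-1.
    by rewrite qD /L /g0; field; rewrite !gt_eqF ?exprn_gt0.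
  have s0 : 0 <= surv r b D e q T by case/andP: (surv01 r b D be01 q01 T).
  rewrite mulrDr mulr1 => H; have : surv r b D e q T / e <= 1 by lra.
  by rewrite ler_pdivrMr ?mul1r.
have cards1x (x : X) : [disjoint [set x] & (set0 : {set X})].
  by rewrite -setI_eq0 setI0.
have EG : E (fun s => #|~: s.1.1|%:R) <= 2 * e * #|X|%:R.
  rewrite /E (eq_expect _ _ _ _ _ (g := fun s => \sum_x ind set0 [set x] s)) => [|s].
    rewrite expect_sum mulrC -sum1_card natr_sum mulr_suml; apply: ler_sum => x _.
    have := app set0 [set x]; rewrite disjoint_sym cards1x => /(_ isT).
    rewrite cards0 cards1 => /(_ isT); rewrite expr0 mul1r expr1 ler_norml.
    by move=> /andP[_]; lra.
  rewrite natr_card; apply: eq_bigr => x _.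
  by rewrite /ind sub0set disjoints1 inE.
have EV : E (fun s => #|s.1.2|%:R) <= 2 * e * #|X|%:R.
  rewrite /E (eq_expect _ _ _ _ _ (g := fun s => \sum_x ind [set x] set0 s)) => [|s].
    rewrite expect_sum mulrC -sum1_card natr_sum mulr_suml; apply: ler_sum => x _.
    have := app [set x] set0; rewrite cards1x => /(_ isT).
    rewrite cards0 cards1 => /(_ isT); rewrite expr0 mulr1 expr1 ler_norml.
    by move=> /andP[_]; move: survT; lra.
  rewrite natr_card; apply: eq_bigr => x _.
  by rewrite /ind sub1set -setI_eq0 set0I eqxx andbT.
have Ewaste : E (waste r) <= e * #|X|%:R.
  apply: le_trans (expect_waste reg be01 q01 T) _; rewrite qD.
  have -> : T%:R * (r.+1%:R * (#|X|%:R * (L / T%:R) ^+ 2)) =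
      #|X|%:R * (r.+1%:R * L ^+ 2 / T%:R) by field; rewrite gt_eqF.
  rewrite mulrC; apply: ler_wpM2r => //.
  rewrite ler_pdivrMr // [leRHS]mulrC -ler_pdivrMr //; apply: le_trans (ltW ZT).
  by rewrite lerDr ltW.
pose cost (s : @state X C) : R := \sum_(F in conf) #|F|%:R * (F \subset s.2)%:R.
have Ecost : r.+1%:R * E cost <= e * #|X|%:R.
  apply: (@le_trans _ _ (r.+1%:R * (ga * #|X|%:R))).
    apply: ler_wpM2l; [exact: ltW|apply: le_trans Hconf].
    rewrite /E expect_sum; apply: ler_sum => F _; rewrite expectZ -Tq.
    by apply: ler_wpM2l => //; apply: expect_sub.
  rewrite mulrA; apply: ler_wpM2r => //; rewrite mulrC -ler_pdivlMr //.
  by rewrite ge_min lexx orbT.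
pose total (s : @state X C) : R :=
  #|~: s.1.1|%:R + #|s.1.2|%:R + waste r s + r.+1%:R * cost s.
have Etotal : E total <= 6 * e * #|X|%:R.
  rewrite /E /total 3!expectD expectZ.
  change (E (fun s => #|~: s.1.1|%:R) + E (fun s => #|s.1.2|%:R)
    + E (waste r) + r.+1%:R * E cost <= 6 * e * #|X|%:R).
  by move: EG EV Ewaste Ecost; lra.
have [s [[VG AW BW dW] Hs]] := expect_le_ex be01 q01 Etotal.
(* All blocks of every selected conflict are deleted; a conflict is nonempty, so this destroys
   it. *)
pose bad := \bigcup_(F in [set F in conf | F \subset s.2]) F.
exists s.1.1, (s.2 :\: bad); split.
- move=> c; rewrite inE => /andP[_ cW]; split; last exact: BW.
  exact: subset_trans (AW _ cW) (subsetDl _ _).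
- by move=> c c'; rewrite !inE => /andP[_ cW] /andP[_ c'W]; apply: dW.
- move=> F Fconf; apply/negP => FM.
  have FW : F \subset s.2 by apply: subset_trans FM (subsetDl _ _).
  have /set0Pn[c cF] : F != set0 by apply: contraNneq conf0 => <-.
  have := subsetP FM _ cF; rewrite inE => /andP[/negP + _]; apply.
  by apply/bigcupP; exists F => //; rewrite inE Fconf.
have badc : #|bad|%:R <= cost s.
  apply: (@le_trans _ _ (\sum_(F in [set F in conf | F \subset s.2]) #|F|)%:R).
    by rewrite ler_nat leq_card_bigcup.
  rewrite natr_sum /cost big_mkcond [leRHS]big_mkcond; apply: ler_sum => F _ /=.
  by rewrite inE; case: (F \in conf) => //=; case: (F \subset _); rewrite ?mulr1 ?mulr0.
have Mcard : #|s.2|%:R - #|bad|%:R <= #|s.2 :\: bad|%:R :> R.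
  rewrite lerBlDr -natrD ler_nat -(cardsID bad s.2) addnC leq_add2l.
  by rewrite subset_leq_card // subsetIr.
(* The covered points, the last summand, are the waste plus [r.+1] times the number of selected
   blocks. *)
have Xcard : #|X|%:R = #|~: s.1.1|%:R + #|s.1.2|%:R + #|s.1.1 :\: s.1.2|%:R :> R.
  rewrite -!natrD -(cardsC s.1.1) -(cardsID s.1.2 s.1.1) (setIidPr VG).
  by congr (_%:R); rewrite addnC addnA.
move: Hs; rewrite /total /waste.
have X0 : 0 <= #|X|%:R :> R by [].
have H1 : r.+1%:R * (#|s.2|%:R - cost s) <= r.+1%:R * #|s.2 :\: bad|%:R.
  by apply: ler_wpM2l; [exact: ltW | lra].
have H2 : 6 * e * #|X|%:R <= eta * #|X|%:R by apply: ler_wpM2r.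
rewrite mulrBl mul1r; move: H1 H2; rewrite mulrBr Xcard; lra.
Qed.

(** * Counting functions with small image *)

Section Counting.
Local Open Scope nat_scope.

(** The values outside [W] number at most [u - #|W|]; padded with [x0] and listed after [W], they
    form a list of [u] points, and the function is recovered from the position of each of its
    values. *)
Lemma card_ffun_small_image {T I : finType} (x0 : T) [W : {set T}] [u] :
  #|W| <= u ->
  #|[set f : {ffun I -> T} | #|W :|: [set f i | i : I]| <= u]|
    <= #|T| ^ (u - #|W|) * u ^ #|I|.
Proof.
move=> Wu.
pose points (g : {ffun 'I_(u - #|W|) -> T}) := enum W ++ codom g.
pose comp (p : {ffun 'I_(u - #|W|) -> T} * {ffun I -> 'I_u}) : {ffun I -> T} :=
  [ffun i => nth x0 (points p.1) (p.2 i)].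
apply: (@leq_trans #|comp @: setT|); last first.
  apply: leq_trans (leq_imset_card _ _) _.
  by rewrite cardsT card_prod !card_ffun !card_ord.
apply/subset_leq_card/subsetP => f; rewrite inE => small.
set V := [set f i | i : I] in small.
have sizeD : #|V :\: W| <= u - #|W|.
  rewrite leq_subRL // cardsD; apply: leq_trans small.
  rewrite cardsU [W :&: V]setIC; have := subset_leq_card (subsetIl V W).
  by move: #|V| #|W| #|V :&: W| => x y z; lia.
pose g : {ffun 'I_(u - #|W|) -> T} :=
  [ffun i : 'I_(u - #|W|) => nth x0 (enum (V :\: W)) i].
have size_points : size (points g) = u.
  by rewrite size_cat size_codom card_ord -cardE subnKC.
have fP i : f i \in points g.
  rewrite mem_cat mem_enum; case: (boolP (f i \in W)) => //= fW.
  have fVW : f i \in enum (V :\: W) by rewrite mem_enum inE fW; apply: imset_f.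
  have lt : index (f i) (enum (V :\: W)) < u - #|W|.
    by apply: leq_trans sizeD; rewrite cardE index_mem.
  by apply/codomP; exists (Ordinal lt); rewrite ffunE nth_index.
have lt i : index (f i) (points g) < u by rewrite -size_points index_mem.
apply/imsetP; exists (g, [ffun i => Ordinal (lt i)]) => //.
by apply/ffunP => i; rewrite !ffunE /= nth_index.
Qed.

(** Each factor of [n ^_ m] is at least [n / 2]. *)
Lemma exp_le_ffact n m : 2 * m <= n -> n ^ m <= 2 ^ m * n ^_ m.
Proof.
elim: m => [|m IH] mn; first by rewrite ffactn0.
rewrite !expnSr ffactnSr -mulnA [2 * _]mulnCA mulnA.
by apply: leq_mul; [apply: IH|]; lia.
Qed.

Lemma ffact_le_exp n m : n ^_ m <= n ^ m.
Proof.
elim: m => [|m IH]; first by rewrite ffactn0.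
by rewrite ffactnSr expnSr leq_mul // leq_subr.
Qed.

(** List each set before its complement and match the two lists entry by entry. *)
Lemma imset_transitive {T : finType} [x y : {set T}] : #|x| = #|y| ->
  exists2 h : T -> T, injective h & h @: x = y.
Proof.
move=> xy.
pose s (z : {set T}) := enum z ++ enum (~: z).
have s_uniq z : uniq (s z).
  rewrite cat_uniq !enum_uniq andbT /=; apply/hasPn => a.
  by rewrite !mem_enum inE.
have s_mem z a : a \in s z by rewrite mem_cat !mem_enum inE orbN.
have s_size z : size (s z) = #|T| by rewrite size_cat -!cardE cardsC.
have lt a : index a (s x) < size (s y) by rewrite s_size -(s_size x) index_mem.
pose h a := nth a (s y) (index a (s x)).
have hE a a0 : h a = nth a0 (s y) (index a (s x)) by apply: set_nth_default.
have h_inj : injective h.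
  move=> a a'; rewrite (hE a' a) /h => /eqP; rewrite nth_uniq // => /eqP eqi.
  by rewrite -(nth_index a (s_mem x a)) eqi nth_index.
exists h => //; apply/eqP; rewrite eqEcard card_imset // xy leqnn andbT.
apply/subsetP => b /imsetP[a ax ->]; rewrite /h.
have ia : index a (s x) < #|y|.
  by rewrite index_cat mem_enum ax -xy cardE index_mem mem_enum.
by rewrite nth_cat -cardE ia -mem_enum mem_nth // -cardE.
Qed.

End Counting.

Notation kset T k := {x : {set T} | #|x| == k}.
Notation embedding U T := {f : {ffun U -> T} | injectiveb f}.

(** * Degrees and codegrees of the system of embeddings *)

Section Embeddings.
Local Open Scope nat_scope.
Context {U T : finType}.
Variables (k : nat).
Hypothesis k_lt : k < #|U|.

Implicit Types (Fam : {set {set U}}) (c : embedding U T) (x y : kset T k).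

Definition images Fam c : {set kset T k} :=
  [set x | val x \in [set val c @: E | E : {set U} in Fam]].

Lemma embedding_inj c : injective (val c).
Proof. exact/injectiveP/(valP c). Qed.

Lemma card_images Fam c :
  (forall E, E \in Fam -> #|E| = k) -> #|images Fam c| = #|Fam|.
Proof.
move=> Famk; rewrite -(card_imset _ val_inj).
rewrite (_ : [set val x | x in images Fam c] = [set val c @: E | E : {set U} in Fam]).
  by rewrite card_imset //; apply/imset_inj/embedding_inj.
apply/setP => z; apply/imsetP/idP => [[x + ->]|zF]; first by rewrite inE.
have zk : #|z| == k.
  by move: zF => /imsetP[E EF ->]; rewrite card_imset ?Famk //; apply: embedding_inj.
by exists (exist (fun x : {set T} => #|x| == k) z zk); rewrite ?inE.
Qed.

Lemma disjoint_images Fam Fam' c :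
  [disjoint Fam & Fam'] -> [disjoint images Fam c & images Fam' c].
Proof.
move=> dF; apply/pred0P => x /=; apply/andP => -[].
rewrite !inE => /imsetP[E EF ->] /imsetP[E' EF' /imset_inj eqE].
by have /pred0P/(_ E) := dF; rewrite /= EF eqE ?EF' //; apply: embedding_inj.
Qed.

Lemma images_sub Fam c x : x \in images Fam c -> val x \subset [set val c u | u : U].
Proof. by rewrite inE => /imsetP[E _ ->]; apply: imsetS; apply/subsetP. Qed.

(** Composition with an injection of [T] carrying [x] to [y] maps the first family of embeddings
    into the second. Exchanging [x] and [y] shows that all degrees agree. *)
Lemma degree_images_le Fam x y :
  #|[set c | x \in images Fam c]| <= #|[set c | y \in images Fam c]|.
Proof.
have [h h_inj hx] := imset_transitive (etrans (eqP (valP x)) (esym (eqP (valP y)))).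
have hc_inj c : injectiveb [ffun u => h (val c u)].
  by apply/injectiveP => u v; rewrite !ffunE => /h_inj /embedding_inj.
pose hc c : embedding U T := exist (fun f : {ffun U -> T} => injectiveb f) _ (hc_inj c).
have hc_injective : injective hc.
  move=> c c' /(congr1 val) /= /ffunP eqc; apply/val_inj/ffunP => u.
  by have := eqc u; rewrite !ffunE => /h_inj.
rewrite -(card_imset _ hc_injective); apply/subset_leq_card/subsetP => _ /imsetP[c + ->].
rewrite !inE => /imsetP[E EF xE]; apply/imsetP; exists E => //.
by rewrite -hx xE -imset_comp /=; apply: eq_imset => u; rewrite ffunE.
Qed.

Lemma card_embedding : #|{: embedding U T}| = #|T| ^_ #|U|.
Proof. by rewrite card_sig -card_inj_ffuns; apply: eq_card => f; rewrite !inE. Qed.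

Lemma card_kset : #|{: kset T k}| = 'C(#|T|, k).
Proof. by rewrite card_sig -card_draws; apply: eq_card => f; rewrite !inE. Qed.

(** The image contains [x] and a point of [y] outside [x]: with [k.+1] points prescribed, at most
    [#|U| - k.+1] remain free. *)
Lemma codegree_images Fam Fam' x y : x != y ->
  #|[set c | (x \in images Fam c) && (y \in images Fam c :|: images Fam' c)]|
    <= #|T| ^ (#|U| - k.+1) * #|U| ^ #|U|.
Proof.
move=> xy; have [z zy zx] : exists2 z, z \in val y & z \notin val x.
  apply/subsetPn; apply: contra xy => yx; rewrite eq_sym -val_eqE.
  by rewrite eqEcard yx (eqP (valP x)) (eqP (valP y)) /=.
have cardW : #|z |: val x| = k.+1 by rewrite cardsU1 zx (eqP (valP x)).
have W_le : #|z |: val x| <= #|U| by rewrite cardW.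
rewrite -(card_imset _ val_inj) -cardW.
apply: leq_trans (card_ffun_small_image z W_le).
apply/subset_leq_card/subsetP => _ /imsetP[c cxy ->]; rewrite in_set.
have /andP[xc yc] : (x \in images Fam c) && (y \in images Fam c :|: images Fam' c).
  by rewrite in_set in cxy.
have im_le : #|[set val c u | u : U]| <= #|U| by apply: leq_imset_card.
rewrite (setUidPr _) // subUset sub1set (images_sub xc) andbT.
have yim : val y \subset [set val c u | u : U].
  by move: yc; rewrite in_setU => /orP[] /images_sub.
exact: subsetP yim _ zy.
Qed.

Lemma degree_images Fam (x0 : kset T k) : (forall E, E \in Fam -> #|E| = k) ->
  'C(#|T|, k) * #|[set c | x0 \in images Fam c]| = #|Fam| * #|T| ^_ #|U|.
Proof.
move=> Famk; rewrite -card_kset -card_embedding mulnC.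
transitivity (\sum_(x : kset T k) \sum_c (x \in images Fam c)).
  rewrite mulnC -sum_nat_const; apply: eq_bigr => x _.
  rewrite (_ : #|_| = #|[set c | x \in images Fam c]|); last first.
    by apply/eqP; rewrite eqn_leq !degree_images_le.
  rewrite -sum1_card big_mkcond; apply: eq_bigr => c _.
  by rewrite inE; case: (x \in _).
rewrite exchange_big /= mulnC -sum_nat_const; apply: eq_bigr => c _.
rewrite -(card_images c Famk) -sum1_card.
by rewrite [RHS]big_mkcond; apply: eq_bigr => x _; case: (x \in _).
Qed.
End Embeddings.

(** * Near-regularity and the number of conflicts *)

Section Conflicts.
Context {R : realType} {U T : finType}.
Variables (k e : nat).
Hypotheses (k_gt0 : (0 < k)%N) (k_lt : (k < #|U|)%N) (large : (2 * #|U| <= #|T|)%N).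

Implicit Types (Fam : {set {set U}}) (c : embedding U T) (x y : kset T k).

(** Degrees have order [#|T| ^ (#|U| - k)] and codegrees lose a factor [#|T|]. The constant
    [2 ^ #|U|] comes from [exp_le_ffact], and [#|U| ^ #|U|] from [codegree_images]. *)
Lemma embeddings_regular (EE : {set {set U}}) r (ga : R) :
  (forall E, E \in EE -> #|E| = k) -> #|EE| = r.+1 -> 0 <= ga ->
  (2 ^ #|U| * #|U| ^ #|U|)%:R <= ga * #|T|%:R ->
  exists D, nearly_regular (C := embedding U T) (images k EE)
      (images k ([set E : {set U} | #|E| == k] :\: EE))
      r #|[set E : {set U} | #|E| == k] :\: EE| D ga
    /\ (#|T| ^ (#|U| - k) <= 2 ^ #|U| * D)%N.
Proof.
move=> EEk EEr ga0 ga_large; set NE := _ :\: EE.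
have NEk (E : {set U}) : E \in NE -> #|E| = k by rewrite !inE => /andP[_ /eqP].
have x0 : kset T k.
  have : (0 < #|{: kset T k}|)%N by rewrite card_kset bin_gt0; lia.
  by move=> /card_gt0P/sigW[x _].
pose D := #|[set c : embedding U T | x0 \in images k EE c]|.
have D_large : (#|T| ^ (#|U| - k) <= 2 ^ #|U| * D)%N.
  have T0 : (0 < #|T| ^ k)%N by rewrite expn_gt0; apply/orP; left; lia.
  rewrite -(leq_pmul2l T0) -expnD subnKC ?(ltnW k_lt) //.
  apply: leq_trans (exp_le_ffact large) _; rewrite mulnCA leq_mul2l.
  apply/orP; right; apply: (@leq_trans ('C(#|T|, k) * D)%N).
    by rewrite degree_images // EEr leq_pmull.
  rewrite leq_mul2r; apply/orP; right.
  apply: (@leq_trans ('C(#|T|, k) * k`!)%N); first by rewrite leq_pmulr ?fact_gt0.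
  rewrite bin_ffact.
  exact: ffact_le_exp.
exists D; split=> //.
have T0 : (0 < #|T|)%N by lia.
have codeg : (#|T| ^ (#|U| - k.+1) * #|U| ^ #|U|)%:R <= ga * D%:R.
  have p2 : 0 < (2 ^ #|U|)%:R :> R by rewrite ltr0n expn_gt0.
  rewrite -(ler_pM2l p2) mulrCA -natrM.
  apply: (@le_trans _ _ (ga * (#|T| ^ (#|U| - k))%:R)); last first.
    by rewrite ler_wpM2l // -natrM ler_nat.
  have -> : (#|U| - k = (#|U| - k.+1).+1)%N by rewrite subnSK.
  rewrite expnS [in leRHS]natrM [leRHS]mulrA mulnCA [leLHS]natrM [leLHS]mulrC.
  by rewrite ler_wpM2r.
split=> //.
- by move=> c; rewrite card_images.
- by move=> c; rewrite card_images.
- by move=> c; apply: disjoint_images; rewrite -setI_eq0 setIDA setDIl setDv set0I.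
- by move=> x; apply/eqP; rewrite eqn_leq !degree_images_le.
- move=> x y xy; apply: le_trans codeg; rewrite ler_nat.
  exact: codegree_images.
- apply: le_trans codeg; rewrite ler1n muln_gt0 !expn_gt0 T0 /=.
  by rewrite (leq_ltn_trans _ k_lt).
Qed.

Definition image_set (f : {ffun U -> T}) : {set T} := [set f u | u : U].

Definition conflicts : {set {set embedding U T}} :=
  [set F : {set embedding U T} | (2 <= #|F| <= e)%N &&
     (#|\bigcup_(c in F) image_set (val c)| < #|F| * #|U| - (#|F| - 1) * k)%N].

(** The largest number of vertices that a conflict of [l] embeddings can span, as its defining
    inequality is strict. *)
Definition conflict_span l := (l * #|U| - (l - 1) * k - 1)%N.

(** The [l] embeddings, listed, form one function on ['I_l * U] with small image, and this function
    determines the set. *)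
Lemma card_conflicts l :
  (#|[set F in conflicts | #|F| == l]|
     <= #|T| ^ conflict_span l * conflict_span l ^ (l * #|U|))%N.
Proof.
have x0 : T by have /card_gt0P/sigW[x _] : (0 < #|T|)%N by lia.
have W0 : (#|set0 : {set T}| <= conflict_span l)%N by rewrite cards0.
have := @card_ffun_small_image T ('I_l * U)%type x0 set0 _ W0.
rewrite cards0 subn0 card_prod card_ord; apply: leq_trans.
pose collect (f : {ffun 'I_l * U -> T}) : {set embedding U T} :=
  [set c : embedding U T | [exists i, [forall u, val c u == f (i, u)]]].
apply: leq_trans (leq_imset_card collect _).
apply/subset_leq_card/subsetP => F; rewrite inE => /andP[+ /eqP Fl].
rewrite inE Fl => /andP[_ small].
have lt (i : 'I_l) : (i < #|F|)%N by rewrite Fl.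
pose f := [ffun p : 'I_l * U => val (enum_val (Ordinal (lt p.1))) p.2].
apply/imsetP; exists f.
  rewrite inE set0U; apply: (@leq_trans #|\bigcup_(c in F) image_set (val c)|).
    apply/subset_leq_card/subsetP => _ /imsetP[p _ ->]; rewrite ffunE.
    apply/bigcupP; exists (enum_val (Ordinal (lt p.1))); first exact: enum_valP.
    exact: imset_f.
  by rewrite /conflict_span subn1 -ltnS prednK //; apply: leq_ltn_trans small.
apply/setP => c; rewrite inE; apply/idP/existsP => [cF|[i /forallP ci]].
  have ltc : (enum_rank_in cF c < l)%N by rewrite -Fl.
  exists (Ordinal ltc); apply/forallP => u; rewrite ffunE /=.
  rewrite (_ : Ordinal _ = enum_rank_in cF c) ?enum_rankK_in //.
  exact: val_inj.
rewrite (_ : c = enum_val (Ordinal (lt i))); first exact: enum_valP.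
by apply/val_inj/ffunP => u; have /eqP := ci u; rewrite ffunE.
Qed.

Definition conflict_const (K : R) : R :=
  \sum_(l < e.+1) l%:R * (conflict_span l ^ (l * #|U|))%:R * (K * 2 ^+ #|U|) ^+ l.

(** The exponents balance: [conflict_span l] is [l * (#|U| - k) + k.-1], and [(K / D) ^+ l] gains
    back [l * (#|U| - k)], so [#|T| ^ k.-1] is left for every [l]. *)
Lemma sum_conflicts (K : R) D : 0 <= K -> (0 < D)%N ->
  (#|T| ^ (#|U| - k) <= 2 ^ #|U| * D)%N ->
  \sum_(F in conflicts) #|F|%:R * (K / D%:R) ^+ #|F|
    <= conflict_const K * (#|T| ^ k.-1)%:R.
Proof.
move=> K0 D0 D_large.
have T0 : (0 < #|T|)%N by lia.
have KD0 : 0 <= K / D%:R by apply: divr_ge0.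
(* [inord] loses nothing here, as conflicts have at most [e] members. *)
rewrite (partition_big (fun F : {set embedding U T} => inord #|F| : 'I_e.+1) xpredT) //=.
rewrite /conflict_const mulr_suml; apply: ler_sum => l _.
have inordE F : F \in conflicts -> (inord #|F| == l) = (#|F| == l).
  rewrite inE => /andP[/andP[_ Fe] _].
  by rewrite -val_eqE /= inordK.
case: (ltnP l 2) => l2.
  rewrite big1 => [|F /andP[Fc]].
    by rewrite !mulr_ge0 // exprn_ge0 // mulr_ge0 // exprn_ge0.
  rewrite inordE // => /eqP Fl; move: Fc.
  by rewrite inE Fl leqNgt l2.
rewrite (eq_bigr (fun=> l%:R * (K / D%:R) ^+ l)) => [|F /andP[Fc]]; last first.
  by rewrite inordE // => /eqP ->.
rewrite sumr_const -[leLHS]mulr_natl.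
have -> : #|[pred F | (F \in conflicts) && (inord #|F| == l)]|
    = #|[set F in conflicts | #|F| == l]|.
  apply: eq_card => F; rewrite !inE /=; case: (boolP (F \in conflicts)) => Fc.
    by have := Fc; rewrite inE => ->; rewrite inordE.
  by move: Fc; rewrite inE => /negbTE ->.
have g0 : 0 <= l%:R * (K / D%:R) ^+ l by rewrite mulr_ge0 // exprn_ge0.
have := card_conflicts l; rewrite -(ler_nat R) => /(ler_wpM2r g0)/le_trans; apply.
have KD : K / D%:R <= K * 2 ^+ #|U| / (#|T| ^ (#|U| - k))%:R.
  rewrite -mulrA; apply: ler_wpM2l => //.
  rewrite ler_pdivlMr ?ltr0n ?expn_gt0 ?T0 // mulrC ler_pdivrMr ?ltr0n //.
  by rewrite -natrX -natrM ler_nat.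
have KDl : (K / D%:R) ^+ l <= (K * 2 ^+ #|U|) ^+ l / ((#|T| ^ (#|U| - k)) ^ l)%:R.
  rewrite natrX -expr_div_n; apply: lerXn2r; rewrite ?nnegrE //.
  exact: le_trans KD.
set v := conflict_span l.
apply: (@le_trans _ _ ((#|T| ^ v * v ^ (l * #|U|))%:R *
   (l%:R * ((K * 2 ^+ #|U|) ^+ l / ((#|T| ^ (#|U| - k)) ^ l)%:R)))).
  by rewrite !ler_wpM2l.
have -> : (#|T| ^ v = (#|T| ^ (#|U| - k)) ^ l * #|T| ^ k.-1)%N.
  rewrite -expnM -expnD; congr (_ ^ _)%N; rewrite /v /conflict_span.
  case: k k_gt0 k_lt => // k' _ klt; rewrite mulnBl mulnBl mul1n /=.
  have : (l * k'.+1 <= l * #|U|)%N by rewrite leq_mul2l (ltnW klt) orbT.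
  have : (k'.+1 <= l * k'.+1)%N by rewrite leq_pmull // (ltnW l2).
  rewrite [(#|U| * l)%N]mulnC [(k'.+1 * l)%N]mulnC.
  by move: (l * k'.+1)%N (l * #|U|)%N => x y; lia.
have P0 : ((#|T| ^ (#|U| - k)) ^ l)%:R != 0 :> R.
  by rewrite pnatr_eq0 -lt0n !expn_gt0 T0.
rewrite le_eqVlt; apply/orP; left; apply/eqP; rewrite !natrM.
by field.
Qed.

End Conflicts.

(** * From the nibble to the packing *)

Lemma sparse_embeddings {R : realType} (k e : nat) (U : finType)
    (EE : {set {set U}}) (eta : R) :
  (0 < k < #|U|)%N -> (forall E, E \in EE -> #|E| = k) -> (0 < #|EE|)%N ->
  0 < eta ->
  exists n0, forall T : finType, (n0 <= #|T|)%N ->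
  exists M : {set embedding U T},
    [/\ forall c c', c \in M -> c' \in M -> c != c' ->
          forall E E' : {set U}, E \in EE -> #|E'| = k -> val c @: E != val c' @: E',
        forall F : {set embedding U T}, F \subset M -> (2 <= #|F| <= e)%N ->
          (#|F| * #|U| - (#|F| - 1) * k <= #|\bigcup_(c in F) image_set (val c)|)%N &
        (1 - eta) * 'C(#|T|, k)%:R <= #|EE|%:R * #|M|%:R].
Proof.
move=> /andP[k0 km] EEk EE0 eta0; pose r := #|EE|.-1.
have EEr : #|EE| = r.+1 by rewrite prednK.
pose NE := [set E : {set U} | #|E| == k] :\: EE.
have [K [ga [K0 ga0 Hnib]]] := @nibble R r #|NE| eta eta0.
pose cst : R := @conflict_const R U k e K.
have cst0 : 0 <= cst.
  apply: sumr_ge0 => l _; apply: mulr_ge0; first exact: mulr_ge0.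
  by apply: exprn_ge0; apply: mulr_ge0; [exact: ltW | exact: exprn_ge0].
(* The first summand serves near-regularity and the second the conflicts, where [2 ^ k * k!]
   converts [#|T| ^ k] into a binomial coefficient. *)
pose Z := ((2 ^ #|U| * #|U| ^ #|U|)%:R + cst * (2 ^ k * k`!)%:R) / ga.
have c0 : 0 <= cst * (2 ^ k * k`!)%:R by apply: mulr_ge0.
have Z0 : 0 <= Z by apply: divr_ge0; [exact: addr_ge0 | exact: ltW].
exists (2 * #|U| + (Num.trunc Z).+1)%N => T Tlarge.
have large : (2 * #|U| <= #|T|)%N by lia.
have ZT : Z <= #|T|%:R.
  have /andP[_ /ltW H] := truncn_itv Z0; apply: le_trans H _.
  by rewrite ler_nat; lia.
have gaT : (2 ^ #|U| * #|U| ^ #|U|)%:R + cst * (2 ^ k * k`!)%:R <= ga * #|T|%:R.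
  by rewrite [leRHS]mulrC -ler_pdivrMr.
have [|D [reg D_large]] := embeddings_regular (R := R) k0 km large EEk EEr (ltW ga0).
  by apply: le_trans gaT; rewrite lerDl.
have D0 : (0 < D)%N.
  have : (0 < #|T| ^ (#|U| - k))%N by rewrite expn_gt0; apply/orP; left; lia.
  by move=> /leq_trans/(_ D_large); rewrite muln_gt0 => /andP[].
pose conf := @conflicts U T k e.
have conf0 : set0 \notin conf by rewrite inE cards0.
have confsum : \sum_(F in conf) #|F|%:R * (K / D%:R) ^+ #|F|
    <= ga * #|{: {x : {set T} | #|x| == k}}|%:R.
  apply: le_trans (sum_conflicts e k0 km large (ltW K0) D0 D_large) _.
  rewrite card_kset -/cst.
  have p0 : 0 < (2 ^ k * k`!)%:R :> R by rewrite ltr0n muln_gt0 expn_gt0 fact_gt0.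
  rewrite -(ler_pM2r p0) mulrAC.
  apply: (@le_trans _ _ (ga * #|T|%:R * (#|T| ^ k.-1)%:R)).
    by apply: ler_wpM2r => //; apply: le_trans gaT; rewrite lerDr.
  rewrite -!mulrA -!natrM -expnS prednK //; apply: ler_wpM2l; first exact: ltW.
  rewrite ler_nat mulnCA bin_ffact; apply: exp_le_ffact.
  by lia.
have [G [M [MG Mdis Mconf Mcard]]] := Hnib _ _ _ _ _ _ reg conf0 confsum.
exists M; split.
(* A common image is a point of [G], being an edge of the copy [c]. If [E'] is in [EE], two selected
   copies share this edge; otherwise it is a non-edge of the copy [c'], and those avoid [G]. *)
- move=> c c' cM c'M nc E E' EE1 E'k; apply/eqP => eqE.
  have Ek : #|val c @: E| == k.
    by rewrite card_imset ?EEk //; apply: embedding_inj.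
  pose x : {x : {set T} | #|x| == k} := exist (fun x : {set T} => #|x| == k) _ Ek.
  have xA : x \in images k EE c by rewrite inE; apply: imset_f.
  have xG : x \in G by have [/subsetP AG _] := MG _ cM; apply: AG.
  case: (boolP (E' \in EE)) => E'EE.
    have /pred0P/(_ x) := Mdis _ _ cM c'M nc; rewrite /= xA /=.
    by rewrite inE /= eqE imset_f.
  have [_ /pred0P/(_ x)] := MG _ c'M; rewrite /= xG andbT.
  by rewrite inE /= eqE imset_f // !inE E'EE E'k eqxx.
- move=> F FM Fe; rewrite leqNgt; apply/negP => small.
  by have := Mconf F; rewrite inE Fe small FM => /(_ isT).
- by move: Mcard; rewrite card_kset EEr.
Qed.

Theorem lemma3p1 (R : realType) (k m e : nat)
    (hk : (1 <= k)%N) (hm : (k < m)%N) (he : (2 <= e)%N)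
    (U : finType) (J : hypergraph U)
    (hJk : is_kgraph k J) (hJm : #|vset J| = m) (hJe : (2 <= #|edges J|)%N) :
  forall eps : R, 0 < eps ->
  exists n0 : nat, forall n : nat, (n0 <= n)%N ->
  exists (N : nat) (P : 'I_N -> hypergraph 'I_n),
    is_packing J P /\
    is_induced k P /\
    locally_sparse k m e P /\
    (1 - eps) * 'C(n, k)%:R / #|edges J|%:R <= N%:R.
Proof.
(* [U] may have elements outside [vset J], so the blocks are embeddings of the subtype [V], which
   has exactly [m] elements. *)
move=> eps eps0; pose V : finType := {u | u \in vset J}.
have cardV : #|V| = m by rewrite card_sig -hJm; apply: eq_card.
have v0 : V by have /card_gt0P/sigW[v _] : (0 < #|V|)%N by lia.
pose pull (E : {set U}) : {set V} := [set v | val v \in E].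
have valpull (E : {set U}) : E \in edges J -> val @: pull E = E.
  move=> /hJk[/subsetP EV _]; apply/setP => u; apply/imsetP/idP => [[v + ->]|uE].
    by rewrite inE.
  by exists (exist (fun u => u \in vset J) u (EV _ uE)); rewrite ?inE.
have cardpull E : E \in edges J -> #|pull E| = k.
  by move=> EJ; rewrite -(card_imset _ val_inj) valpull //; case: (hJk _ EJ).
pose EE := [set pull E | E in edges J].
have cardEE : #|EE| = #|edges J|.
  rewrite card_in_imset // => E E' EJ E'J eqE.
  by rewrite -(valpull _ EJ) -(valpull _ E'J) eqE.
have EEk E : E \in EE -> #|E| = k by move=> /imsetP[E' EJ ->]; apply: cardpull.
have kV : (0 < k < #|V|)%N by rewrite cardV hk.
have EE0 : (0 < #|EE|)%N by rewrite cardEE; lia.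
have [n0 Hn0] := @sparse_embeddings R k e V EE eps kV EEk EE0 eps0.
exists n0 => n n0n; have [|M [Mcross Msparse Mcard]] := Hn0 'I_n.
  by rewrite card_ord.
pose c (i : 'I_#|M|) := enum_val i.
have cM i : c i \in M by apply: enum_valP.
have c_inj : injective c by apply: enum_val_inj.
(* Outside [vset J] this takes the value at the default [v0], which no copy sees. *)
pose F i u : 'I_n := val (c i) (insubd v0 u).
have Fimage i E : E \in edges J -> F i @: E = val (c i) @: pull E.
  move=> EJ; rewrite -{1}(valpull _ EJ) -imset_comp; apply: eq_imset => v /=.
  by rewrite /F valKd.
have Fvset i : F i @: vset J = image_set (val (c i)).
  apply/setP => x; apply/imsetP/imsetP => -[u uV ->].
    by exists (insubd v0 u).
  by exists (val u); rewrite ?(valP u) // /F valKd.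
pose P i : hypergraph 'I_n :=
  Hypergraph (F i @: vset J) [set F i @: E | E : {set U} in edges J].
exists #|M|, P.
have Psize i : #|vset (P i)| = m.
  by rewrite /= Fvset card_imset // ; apply: embedding_inj.
have cross i j (E : {set U}) (Y : {set V}) : i != j -> E \in edges J -> #|Y| = k ->
    F i @: E != val (c j) @: Y.
  move=> ij EJ Yk; rewrite Fimage //; apply: Mcross => //.
    by rewrite (inj_eq c_inj).
  exact: imset_f.
have not_edge i j : i != j -> #|vset (P i) :&: vset (P j)| = k ->
    vset (P i) :&: vset (P j) \notin edges (P i).
  move=> ij /= Ik; apply/imsetP => -[E EJ eqE].
  (* Pulled back along the copy [j], the common set is a [k]-subset of [V], edge or not, so [cross]
     forbids it to be an edge of the copy [i]. *)
  pose Y := [set v | val (c j) v \in F i @: vset J :&: F j @: vset J].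
  have YI : val (c j) @: Y = F i @: vset J :&: F j @: vset J.
    apply/setP => x; apply/imsetP/idP => [[v + ->]|xI]; first by rewrite inE.
    have := xI; rewrite inE => /andP[_]; rewrite Fvset => /imsetP[v _ xv].
    by exists v; rewrite // inE -xv.
  have Yk : #|Y| = k by rewrite -Ik -YI card_imset //; apply: embedding_inj.
  by have /eqP := cross i j E Y ij EJ Yk; apply; rewrite YI eqE.
have Pind : is_induced k P.
  move=> i j ij; split; last first.
    by move=> Ik; split; [exact: not_edge | rewrite setIC not_edge 1?eq_sym // setIC].
  (* Sparsity for two copies: a union of at least [2 * m - k] vertices means an intersection of at
     most [k]. *)
  have := Msparse [set c i; c j]; rewrite cards2 (inj_eq c_inj) ij he => /(_ _ isT).
  rewrite bigcup_setU !big_set1 -!Fvset subUset !sub1set !cM => /(_ isT).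
  have := cardsUI (vset (P i)) (vset (P j)); rewrite !Psize /= cardV.
  by lia.
split; [split|split; [|split]] => //.
- move=> i; exists (F i); split=> // u v uV vV.
  rewrite /F => /embedding_inj /(congr1 val); by rewrite !insubdK.
- move=> i j ij; apply/pred0P => X /=; apply/andP => -[/imsetP[E EJ ->] /imsetP[E' E'J]].
  by rewrite [RHS]Fimage //; apply/eqP/cross => //; apply: cardpull.
- rewrite (locally_sparse_indexE _ hm Psize Pind) => l l2 S Sl.
  have := Msparse (c @: S); rewrite card_imset // Sl => /(_ _ l2).
  rewrite cardV big_imset /=; last by move=> ? ? _ _; apply: c_inj.
  under eq_bigr do rewrite -Fvset.
  by apply; apply/subsetP => _ /imsetP[i _ ->].
- rewrite ler_pdivrMr ?ltr0n; last by lia.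
  by move: Mcard; rewrite cardEE card_ord mulrC [leRHS]mulrC.
Qed.
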